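(* Assume (A1), (A2), (A3). Then, as $\sigma_0\to0$, the law of $(\tilde\mu^{\sigma_0}_t)_{t\in[0,T]}$ on $C([0,T];\mathbb{R})$ converges weakly to $$\tfrac12\delta_{(k_t)_{t\in[0,T]}}+\tfrac12\delta_{(-k_t)_{t\in[0,T]}}.$$
   Context: Fix $T>0$, $\kappa\in\mathbb{R}$, $\delta\in(0,T)$. Let $\eta$ solve $\eta_t'=\eta_t^2-2\kappa\eta_t-1$, $\eta_T=1$ on $[0,T]$; set $w_t=\exp(\int_t^T(\eta_s-\kappa)ds)$, $r_t=\int_t^Tw_s^{-2}ds$, $k_t=\int_0^tw_s^{-2}ds$. The function $\theta:[0,T]\times\mathbb{R}\to\mathbb{R}$ is defined by $\theta(t,x)=-\mathrm{sign}(x)$ if $t\le\delta$; $\theta(t,x)=-\mathrm{sign}(x)$ if $t\ge\delta$ and $|x|\ge r_\delta-r_t$; $\theta(t,x)=-x/(r_\delta-r_t)$ if $t>\delta$ and $|x|<r_\delta-r_t$. A curve $\psi\in C([0,T];\mathbb{R})$ is admissible if it is non-negative, non-decreasing, and there is $a<\delta$ with $\psi_t>(r_\delta-r_t)_+$ for all $t\in(a,T]$. For each $\sigma_0\in(0,1)$ let $\tilde\theta^{\sigma_0}:[0,T]\times\mathbb{R}\to[-1,1]$ be continuous. (A1) There is $L:(0,\infty)\to(0,\infty)$ with $L(\sigma_0)\to+\infty$ and $L(\sigma_0)|\ln\sigma_0|^{-1/8}\to0$ as $\sigma_0\to0$, such that for every admissible $\psi$, $\lim_{\sigma_0\to0}\sup_{t\in[0,T],|x|\ge\sigma_0^2L(\sigma_0)+\psi_t}|\tilde\theta^{\sigma_0}(t,x)-\theta(t,x)|=0$.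 (A2) For each $\sigma_0$, on a filtered probability space carrying a Brownian motion $B$, there are continuous real-valued adapted processes $\tilde\mu^{\sigma_0},\tilde Y^{\sigma_0},\Delta^{\sigma_0}$, with $\tilde Y^{\sigma_0}$ valued in $[-1,1]$, such that $\tilde\mu^{\sigma_0}_t=-\int_0^tw_s^{-2}\tilde Y^{\sigma_0}_sds+\sigma_0\int_0^tw_s^{-1}dB_s$ and $\tilde Y^{\sigma_0}_t=\tilde\theta^{\sigma_0}(t,\tilde\mu^{\sigma_0}_t)-\Delta^{\sigma_0}_t$ for $t\in[0,T]$, and $\sup_{t\in[0,T]}|\Delta^{\sigma_0}_t|\to0$ in probability as $\sigma_0\to0$. (A3) For each $\sigma_0$, the law of $\tilde\mu^{\sigma_0}$ on $C([0,T];\mathbb{R})$ equals the law of $-\tilde\mu^{\sigma_0}$. *)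

(* Defs.v *)
From HB Require Import structures.
From mathcomp Require Import all_boot all_order all_algebra.
From mathcomp Require Import all_classical all_reals all_analysis.
Set Implicit Arguments. Unset Strict Implicit. Unset Printing Implicit Defensive.
Import Order.TTheory GRing.Theory Num.Def Num.Theory.
Import numFieldNormedType.Exports.
Local Open Scope classical_set_scope.
Local Open Scope ring_scope.

Section Defs.
Context {R : realType}.

Definition riccati_sol (T kappa : R) (eta : R -> R) : Prop :=
  {within `[0, T], continuous eta} /\
  (forall t, 0 < t < T ->
     is_derive t (1 : R) eta (eta t ^+ 2 - 2 * kappa * eta t - 1)) /\
  eta T = 1.

Definition wfun (T kappa : R) (eta : R -> R) (t : R) : R :=
  expR (Rintegral (@lebesgue_measure R) `[t, T] (fun s => eta s - kappa)).

Definition rfun (T kappa : R) (eta : R -> R) (t : R) : R :=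
  Rintegral (@lebesgue_measure R) `[t, T] (fun s => (wfun T kappa eta s) ^- 2).

Definition kfun (T kappa : R) (eta : R -> R) (t : R) : R :=
  Rintegral (@lebesgue_measure R) `[0, t] (fun s => (wfun T kappa eta s) ^- 2).

Definition theta (T kappa delta : R) (eta : R -> R) (t x : R) : R :=
  let r := rfun T kappa eta in
  if (t <= delta) || (r delta - r t <= `|x|) then - Num.sg x
  else - (x / (r delta - r t)).

Definition admissible (T kappa delta : R) (eta : R -> R) (psi : R -> R) : Prop :=
  let r := rfun T kappa eta in
  {within `[0, T], continuous psi} /\
  (forall t, 0 <= t <= T -> 0 <= psi t) /\
  (forall s t, 0 <= s -> s <= t -> t <= T -> psi s <= psi t) /\
  exists a, a < delta /\
    forall t, 0 <= t -> a < t -> t <= T -> Num.max (r delta - r t) 0 < psi t.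

Definition cont_on_strip (T : R) (f : R -> R -> R) : Prop :=
  forall t x, 0 <= t <= T -> forall e, 0 < e -> exists2 d, 0 < d &
    forall t' x', 0 <= t' <= T -> `|t - t'| < d -> `|x - x'| < d ->
      `|f t x - f t' x'| < e.

Definition bcont_functional (T : R) (F : (R -> R) -> R) : Prop :=
  (exists M : R, forall x, {within `[0, T], continuous x} -> `|F x| <= M) /\
  (forall x, {within `[0, T], continuous x} ->
     forall e, 0 < e -> exists2 d, 0 < d &
       forall y, {within `[0, T], continuous y} ->
         (forall t, 0 <= t <= T -> `|x t - y t| < d) -> `|F x - F y| < e).

(* Borel sigma-algebra of C([0,T];R), i.e. the sigma-algebra on paths
   generated by the evaluation maps x |-> x t, t in [0,T] *)
Definition path_sigma (T : R) : set (set (R -> R)) :=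
  <<s [set (fun x : R -> R => x t) @^-1` U |
         t in `[0, T] & U in [set U : set R | measurable U]] >>.

Context {d : measure_display} {Omega : measurableType d}.

Definition filtration (Fil : R -> set (set Omega)) : Prop :=
  (forall t, sigma_algebra setT (Fil t)) /\
  (forall t, Fil t `<=` measurable) /\
  (forall s t, s <= t -> Fil s `<=` Fil t).

Definition adapted (T : R) (Fil : R -> set (set Omega)) (X : R -> Omega -> R) :=
  forall t, 0 <= t <= T -> forall U : set R, measurable U -> Fil t (X t @^-1` U).

Definition cont_paths (T : R) (X : R -> Omega -> R) :=
  forall w, {within `[0, T], continuous (fun t => X t w)}.

Definition brownian (T : R) (P : probability Omega R)
    (Fil : R -> set (set Omega)) (B : R -> Omega -> R) : Prop :=
  adapted T Fil B /\
  {ae P, forall w, B 0 w = 0 /\ {within `[0, T], continuous (fun t => B t w)}} /\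
  (forall s t, 0 <= s -> s < t -> t <= T ->
     forall A U, Fil s A -> measurable U ->
       P (A `&` (fun w => B t w - B s w) @^-1` U) =
       (P A * normal_prob 0 (Num.sqrt (t - s)) U)%E).

Definition cvg_in_prob (P : probability Omega R) (X : nat -> Omega -> R)
    (Y : Omega -> R) : Prop :=
  forall e : R, 0 < e -> forall eps : R, 0 < eps -> exists N, forall n, (N <= n)%N ->
    (P [set w | (e < `|X n w - Y w|)%R] < eps%:E)%E.

Definition riemann_dB (g : R -> R) (B : R -> Omega -> R) (t : R) (n : nat)
    (w : Omega) : R :=
  \sum_(i < n.+1)
    g (t * i%:R / n.+1%:R) *
      (B (t * i.+1%:R / n.+1%:R) w - B (t * i%:R / n.+1%:R) w).

End Defs.

(* Main.v *)
(** Write g = 1/w, l = sigma^2 L and N_t = mu_t + int_0^t w^-2 Y ds, which is sigma times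
    the integral of g against B.  As g is Lipschitz, summation by parts in the Riemann
    sums bounds almost surely every increment of N by the oscillation of B over the same
    time interval, so that only B has to be estimated.

    Choose psi_t = (k_t - k_a)^+ with a < delta.  Above the barrier l + psi, (A1) makes the
    drift of |mu| at least (1 - 2 eps) dk.
    - Escape: on a mesh of order sigma^2 an increment of B larger than const * sigma L forces
      |mu| >= 2 l at a mesh point; it has probability at least exp (- const L^2) >= sigma,
      and of order sigma^-2 independent attempts are made within a short time.
    - No return: after the first such mesh point, Ottaviani's inequality on time blocks of
      length 2^j l shows that, up to probability O(1/L), the noise never beats half of the
      drift, so that |mu| stays above the barrier forever.
    Hence mu is uniformly close to k or to -k outside an event of small probability, and
    (A3), applied to the sign of mu_T, gives each alternative a mass close to 1/2. *)
Require Import Defs.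
From HB Require Import structures.
From mathcomp Require Import all_boot all_order all_algebra.
From mathcomp Require Import all_classical all_reals all_analysis.
From mathcomp Require Import measurable_realfun ring lra.
Set Implicit Arguments. Unset Strict Implicit. Unset Printing Implicit Defensive.
Import Order.TTheory GRing.Theory Num.Def Num.Theory.
Import numFieldNormedType.Exports.
Local Open Scope classical_set_scope.
Local Open Scope ring_scope.


(** * Continuity on a segment, and the barrier argument for a single path *)

Section RealLine.
Context {R : realType}.
Implicit Types (a b c s t x y : R) (f g : R -> R).

(** Two obstacles shape the proof. The noise is known only as a limit in probability of Riemann sums
    at each fixed time, and inside the layer the drift is only known to be bounded. Pathwise bounds
    by the oscillation of B answer the first: Gaussian increments and one maximal inequality for B
    then suffice. For the second, an attempt succeeds when one increment of B is large enough to
    cross the whole layer from any starting point. Success depends on B alone, so the attempts are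
    independent whatever [mu] does. The stopping time of the return argument is replaced by a sum
    over the deterministic index of the first mesh point outside the layer. The size sigma^2 L of
    the layer balances two costs. On a mesh of order sigma^2, crossing it takes an increment of
    order L standard deviations, affordable because L^2 is small against |ln sigma|. Afterwards, on
    a time block of length 2^j l, the squared ratio of noise to drift is of order sigma^2 / (2^j l)
    = 1 / (2^j L), summable in j and small because L tends to infinity. The moving part of the
    barrier costs nothing more: it starts at time a, and k_a is a head start that absorbs all later
    losses. *)

Definition cont_on a b f := forall x, a <= x <= b -> forall e, 0 < e ->
  exists2 d, 0 < d & forall y, a <= y <= b -> `|x - y| < d -> `|f x - f y| < e.

Lemma within_contP a b f : {within `[a, b], continuous f} <-> cont_on a b f.
Proof.
split.
  move=> /subspace_continuousP cf x xab e e0.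
  have /cvgrPdist_lt/(_ e e0) := cf x xab.
  rewrite near_withinE => /nbhs_ballP[d /= d0 H].
  by exists d => // y yab xy; apply: (H y) => //=.
move=> cf; apply/subspace_continuousP => x /= xab.
apply/cvgrPdist_lt => e e0; have [d d0 H] := cf x xab e e0.
rewrite near_withinE; apply/nbhs_ballP; exists d => //= y xy yab.
exact: H.
Qed.

Lemma cont_onS a b c t f : a <= c -> t <= b -> cont_on a b f -> cont_on c t f.
Proof.
move=> ac tb cf x /andP[cx xt] e e0.
have [|d d0 H] := cf x _ e e0; first by apply/andP; split; lra.
by exists d => // y /andP[cy yt]; apply: H; apply/andP; split; lra.
Qed.

(** Take the supremum of the points up to which [P] holds throughout: the left-limit step puts it in
    the set, and the right step passes it unless it is [b]. It serves for uniform continuity and, in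
    the barrier argument, to exclude a first failure time. *)
Lemma real_induction a b (P : R -> Prop) : a <= b -> P a ->
  (forall x, a <= x < b -> (forall y, a <= y <= x -> P y) ->
     exists2 d, 0 < d & forall y, x <= y <= b -> y < x + d -> P y) ->
  (forall x, a < x <= b -> (forall y, a <= y < x -> P y) -> P x) ->
  forall x, a <= x <= b -> P x.
Proof.
move=> ab Pa stepR stepL.
pose S := [set x | a <= x <= b /\ forall y, a <= y <= x -> P y].
have Sa : S a.
  split; first by rewrite lexx.
  by move=> y /andP[ay ya]; have -> : y = a by apply/eqP; rewrite eq_le ya.
have supS : has_sup S by split; [exists a | exists b => y [/andP[]]].
pose z := sup S.
have az : a <= z by apply: ub_le_sup => //; case: supS.
have zb : z <= b by apply: ge_sup => //; [exists a | move=> y [/andP[]]].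
have Pltz y : a <= y < z -> P y.
  case/andP => ay yz.
  have z0 : 0 < z - y by rewrite subr_gt0.
  have [u [_ Su]] := sup_adherent z0 supS.
  rewrite -/z => zu; apply: Su; rewrite ay /=; lra.
have Pz : P z.
  have [->//|za] := eqVneq z a.
  by apply: stepL => //; rewrite zb lt_neqAle eq_sym za az.
have Plez y : a <= y <= z -> P y.
  case/andP=> ay; rewrite le_eqVlt => /predU1P[->//|yz].
  by apply: Pltz; rewrite ay.
have [zeb|znb] := eqVneq z b; first by move=> x; rewrite -zeb; exact: Plez.
have zltb : z < b by rewrite lt_neqAle znb.
have [|d d0 Hd] := stepR z _ Plez; first by rewrite az.
pose u := Num.min b (z + d / 2).
have zu : z < u by rewrite lt_min zltb /=; lra.
have ub : u <= b by rewrite ge_min lexx.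
have ud : u <= z + d / 2 by rewrite ge_min lexx orbT.
suff : S u.
  move=> Su; have : u <= z by apply: ub_le_sup => //; case: supS.
  lra.
split; first by apply/andP; split; lra.
move=> y /andP[ay yu]; have [yz|zy] := leP y z; first by apply: Plez; rewrite ay.
by apply: Hd; [apply/andP; split; lra | lra].
Qed.

Lemma cont_on_unif a b f : cont_on a b f -> forall e, 0 < e ->
  exists2 d, 0 < d & forall x y, a <= x <= b -> a <= y <= b ->
    `|x - y| < d -> `|f x - f y| < e.
Proof.
move=> cf e e0.
have [ab|ba] := leP a b; last first.
  by exists 1 => // x y /andP[? ?]; lra.
pose P z := exists2 d, 0 < d & forall x y, a <= x <= z -> a <= y <= z ->
    `|x - y| < d -> `|f x - f y| < e.
suff: P b by [].
have e2 : 0 < e / 2 by lra.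
(* Half of a continuity radius at [z] for [e / 2] is returned. Two close points of [a, t] lie both
   in [a, c], or one is beyond [c] and both are within the full radius of [z], where each comparison
   with [f z] costs [e / 2]. *)
have ext z : a <= z <= b -> exists2 r, 0 < r & forall c t, c <= t -> z - r < c ->
    t < z + r -> t <= b -> P c -> P t.
  move=> zab; have [r r0 Hr] := cf z zab _ e2.
  exists (r / 2); first lra.
  move=> c t ct zc tz tb [d d0 Hd].
  exists (Num.min d (r / 2)); first by rewrite lt_min d0; lra.
  move=> x y /andP[ax xt] /andP[ay yt]; rewrite lt_min => /andP[xyd xyr].
  have pair : z - r < x -> x < z + r -> z - r < y -> y < z + r ->
      `|f x - f y| < e.
    move=> x1 x2 y1 y2.
    have hx : a <= x <= b by rewrite ax (le_trans xt).
    have hy : a <= y <= b by rewrite ay (le_trans yt).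
    have h1 : `|f z - f x| < e / 2.
      by apply: Hr => //; rewrite ltr_norml; clear -x1 x2; lra.
    have h2 : `|f z - f y| < e / 2.
      by apply: Hr => //; rewrite ltr_norml; clear -y1 y2; lra.
    by move: h1 h2; clear; rewrite !ltr_norml; lra.
  have [xc|cx] := leP x c; last first.
    by apply: pair; clear -xyr cx cx xt yt tz zc; move: xyr; rewrite ltr_norml; lra.
  have [yc|cy] := leP y c; last first.
    by apply: pair; clear -xyr cy xc xt yt tz zc; move: xyr; rewrite ltr_norml; lra.
  by apply: Hd => //; apply/andP.
have := @real_induction a b P ab.
apply; last by rewrite ab lexx.
- exists 1 => // x y xa ya _.
  have [-> ->] : x = a /\ y = a by split; apply/eqP; rewrite eq_le andbC.
  by rewrite subrr normr0.
- move=> x /andP[ax xb] Px.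
  have [|r r0 Hr] := ext x; first by rewrite ax ltW.
  exists r => // y /andP[xy yb] yr.
  by apply: (Hr x y) => //; [lra | apply: Px; rewrite ax lexx].
- move=> x /andP[ax xb] Px.
  have [|r r0 Hr] := ext x; first by rewrite xb ltW.
  pose c := Num.max a (x - r / 2).
  have c1 : a <= c by rewrite le_max lexx.
  have c2 : x - r / 2 <= c by rewrite le_max lexx orbT.
  have c3 : c < x by rewrite gt_max ax /=; lra.
  by apply: (Hr c x) => //; [lra | lra | lra | apply: Px; rewrite c1].
Qed.

Lemma cont_on_bounded a b f : cont_on a b f ->
  exists2 M, 0 < M & forall x, a <= x <= b -> `|f x| <= M.
Proof.
move=> /within_contP cf.
have /compact_bounded[M [_ HM]] :=
  continuous_compact cf (@segment_compact _ a b).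
exists (`|M| + 1); first by have := normr_ge0 M; lra.
move=> x xab; apply: (HM (`|M| + 1)) => /=; first by have := ler_norm M; lra.
by exists x.
Qed.

Lemma lipschitz_cont_on a b f K : (forall x y, a <= x <= b -> a <= y <= b ->
  `|f x - f y| <= K * `|x - y|) -> cont_on a b f.
Proof.
move=> fK x xab e e0; exists (e / (`|K| + 1)).
  by rewrite divr_gt0// ltr_pwDr.
move=> y yab; rewrite ltr_pdivlMr ?ltr_pwDr// => h.
apply: le_lt_trans (fK _ _ xab yab) _.
apply: le_lt_trans h; rewrite mulrC ler_wpM2l//.
by have := ler_norm K; lra.
Qed.

Lemma cont_onD a b f g : cont_on a b f -> cont_on a b g ->
  cont_on a b (fun x => f x + g x).
Proof.
move=> cf cg x xab e e0; have e2 : 0 < e / 2 by lra.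
have [d d0 Hd] := cf x xab _ e2; have [c c0 Hc] := cg x xab _ e2.
exists (Num.min d c); first by rewrite lt_min d0.
move=> y yab; rewrite lt_min => /andP[xyd xyc].
by have := Hd y yab xyd; have := Hc y yab xyc; rewrite !ltr_norml; lra.
Qed.

Lemma cont_onN a b f : cont_on a b f -> cont_on a b (fun x => - f x).
Proof.
move=> cf x xab e e0; have [d d0 Hd] := cf x xab _ e0.
exists d => // y yab xy; have := Hd y yab xy.
by rewrite -normrN opprB opprK addrC.
Qed.

Lemma cont_onM a b f g : cont_on a b f -> cont_on a b g ->
  cont_on a b (fun x => f x * g x).
Proof.
move=> cf cg.
have [Mf Mf0 HMf] := cont_on_bounded cf.
have [Mg Mg0 HMg] := cont_on_bounded cg.
move=> x xab e e0.
have [|d d0 Hd] := cf x xab (e / (2 * Mg)); first by rewrite divr_gt0//; lra.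
have [|c c0 Hc] := cg x xab (e / (2 * Mf)); first by rewrite divr_gt0//; lra.
exists (Num.min d c); first by rewrite lt_min d0.
move=> y yab; rewrite lt_min => /andP[/(Hd y yab)].
rewrite ltr_pdivlMr; last lra.
move=> h1 /(Hc y yab); rewrite ltr_pdivlMr; last lra.
move=> h2.
have -> : f x * g x - f y * g y = (f x - f y) * g x + f y * (g x - g y) by ring.
apply: le_lt_trans (ler_normD _ _) _; rewrite !normrM.
have := HMg x xab; have := HMf y yab.
have := normr_ge0 (f x - f y); have := normr_ge0 (g x - g y).
have := normr_ge0 (f y); have := normr_ge0 (g x).
set p := `|f x - f y| in h1 *; set q := `|g x - g y| in h2 *.
set u := `|f y|; set v := `|g x|; move=> v0 u0 q0 p0 uM vM.
nra.
Qed.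

Lemma cont_on_cst a b c : cont_on a b (fun=> c).
Proof. by move=> x _ e e0; exists 1 => // y _ _; rewrite subrr normr0. Qed.

(* The hypotheses say that [mu] has drift at least (1 - eps) dk whenever it lies
   above the barrier l + (k_t - k_a)_+ and that the noise [N] never beats half of
   that drift after [s]; continuity then prevents [mu] from touching the barrier. *)
Lemma barrier_trap (T s a l eps rho : R) (mu N k Y : R -> R) :
  0 <= s -> s <= a -> a <= T -> 0 < l -> 0 <= eps <= 1 ->
  cont_on 0 T mu -> cont_on 0 T k ->
  (forall u t, 0 <= u -> u <= t -> t <= T -> k u <= k t) ->
  (forall u t, 0 <= u -> u <= t -> t <= T ->
     (forall v, u <= v <= t -> Y v <= - (1 - eps)) ->
     (1 - eps) * (k t - k u) + (N t - N u) <= mu t - mu u) ->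
  (forall t, 0 <= t <= T -> l + Num.max (k t - k a) 0 <= mu t ->
     Y t <= - (1 - eps)) ->
  2 * l <= mu s ->
  (forall t, s <= t <= T ->
     - (l / 2) - (1 - eps) / 2 * (k t - k s) <= N t - N s) ->
  (forall t, s <= t <= T -> - rho <= N t - N s) ->
  eps * (k T - k s) + rho < k a - k s ->
  forall t, s <= t <= T -> (1 - eps) * (k t - k s) - rho <= mu t - mu s.
Proof.
move=> s0 sa aT l0 /andP[eps0 eps1] cmu ck knd H1 H2 mus N1 N2 kas.
pose bar t := l + Num.max (k t - k a) 0.
have cmax : cont_on 0 T (fun t => mu t - l - (k t - k a)).
  apply: cont_onD; last by apply: cont_onN; apply: cont_onD => //; exact: cont_on_cst.
  by apply: cont_onD => //; exact: cont_on_cst.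
(* Staying above the barrier up to [t] improves to strict inequality at [t]. The constant part holds
   since [2 * l <= mu s] and the first noise bound leave at least [3 * l / 2]; the moving part holds
   since the loss [eps * (k t - k s) + rho] is below the head start [k a - k s]. *)
have key t : s <= t <= T -> (forall v, s <= v <= t -> bar v <= mu v) ->
    bar t < mu t /\ (1 - eps) * (k t - k s) - rho <= mu t - mu s.
  move=> /andP[st tT] Hbar.
  have drift : (1 - eps) * (k t - k s) + (N t - N s) <= mu t - mu s.
    apply: H1 => // v /andP[sv vt]; apply: H2; last by apply: Hbar; rewrite sv.
    by apply/andP; split; lra.
  have stT : s <= t <= T by rewrite st.
  have n1 := N1 _ stT; have n2 := N2 _ stT.
  have kst : k s <= k t by apply: knd.
  split; last lra.
  have h1 : l < mu t by nra.
  rewrite /bar -ltrBrDl gt_max; apply/andP; split; last lra.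
  have kT : k t <= k T by apply: knd => //; lra.
  have : eps * (k t - k s) <= eps * (k T - k s) by rewrite ler_wpM2l//; lra.
  by nra.
have sT : s <= T by lra.
suff Hb : forall t, s <= t <= T -> bar t <= mu t.
  move=> t /andP[st tT]; apply: (proj2 (key t _ _)); first by rewrite st.
  by move=> v /andP[sv vt]; apply: Hb; apply/andP; split; lra.
have bars : bar s <= mu s.
  rewrite /bar; have -> : Num.max (k s - k a) 0 = 0; last by lra.
  by apply/max_idPr; rewrite subr_le0; apply: knd.
apply: (real_induction sT) => //.
- move=> x /andP[sx xT] Hx.
  have [|bx _] := key x _ Hx; first by rewrite sx ltW.
  have x0T : 0 <= x <= T by apply/andP; split; lra.
  move: bx; rewrite /bar -ltrBrDl gt_max => /andP[b1 b2].
  have [|d1 d10 D1] := cmax x x0T (mu x - l - (k x - k a)); first lra.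
  have [|d2 d20 D2] := cmu x x0T (mu x - l); first lra.
  exists (Num.min d1 d2); first by rewrite lt_min d10.
  move=> y /andP[xy yT] yd.
  have yxd : `|x - y| < Num.min d1 d2 by rewrite ltr_norml; lra.
  move: yxd; rewrite lt_min => /andP[y1 y2].
  have y0T : 0 <= y <= T by apply/andP; split; lra.
  have := D1 y y0T y1; have := D2 y y0T y2.
  rewrite !ltr_norml => h1 h2; rewrite /bar -lerBrDl ge_max; apply/andP; split; lra.
- move=> x /andP[sx xT] Hx; rewrite leNgt; apply/negP.
  have x0T : 0 <= x <= T by apply/andP; split; lra.
  (* Left limits keep weak inequalities; this is applied separately to the two terms of the maximum
     in [bar]. *)
  have close (f : R -> R) : cont_on 0 T f -> (forall y, s <= y < x -> 0 <= f y) -> 0 <= f x.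
    move=> cf fy; rewrite leNgt; apply/negP => fx.
    have [|d d0 D] := cf x x0T (- f x); first lra.
    pose y := Num.max s (x - d / 2).
    have c1 : s <= y by rewrite le_max lexx.
    have c2 : x - d / 2 <= y by rewrite le_max lexx orbT.
    have c3 : y < x by rewrite gt_max sx /=; lra.
    have := D y ltac:(apply/andP; split; lra) ltac:(rewrite ltr_norml; lra).
    have := fy y ltac:(by rewrite c1).
    rewrite ltr_norml; lra.
  rewrite /bar -ltrBlDl lt_max => /orP[h|h].
  + have /= := close _ cmax.
    apply: contraTnot h => /(_ _)/wrap[]; last by lra.
    move=> y sy; have := Hx y sy.
    rewrite /bar -lerBrDl ge_max; lra.
  + have /= := close (fun t => mu t - l) (cont_onD cmu (@cont_on_cst _ _ _)).
    apply: contraTnot h => /(_ _)/wrap[]; last by lra.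
    move=> y sy; have := Hx y sy.
    rewrite /bar -lerBrDl ge_max; lra.
Qed.

End RealLine.


(** * Integrals of continuous functions over segments *)

Notation segint a b f := (Rintegral (@lebesgue_measure _) `[a, b] f).

Section SegmentIntegral.
Context {R : realType}.
Implicit Types (a b c s t x y : R) (f g : R -> R).

Lemma cont_on_integrable a b f : cont_on a b f ->
  (@lebesgue_measure R).-integrable `[a, b] (EFin \o f).
Proof.
move=> /within_contP cf; apply: continuous_compact_integrable => //.
exact: segment_compact.
Qed.

Lemma segint_split a b c f : a <= c <= b -> cont_on a b f ->
  segint a b f = segint a c f + segint c b f.
Proof.
move=> /andP[ac cb] cf.
have := @Rintegral_itvB _ f (BLeft a) (BRight b) c (cont_on_integrable cf).
rewrite !bnd_simp => /(_ ac cb) h.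
rewrite -(@Rintegral_itv_obnd_cbnd _ c); last first.
  by apply: integrableS (cont_on_integrable cf) => //; apply: subset_itvr; rewrite bnd_simp.
by rewrite -h addrC subrK.
Qed.

Lemma segint_le a b f g : cont_on a b f -> cont_on a b g ->
  (forall x, a <= x <= b -> f x <= g x) -> segint a b f <= segint a b g.
Proof.
move=> cf cg fg; apply: le_Rintegral => //; try exact: cont_on_integrable.
Qed.

Lemma segint_cst a b c : a <= b -> segint a b (fun=> c) = c * (b - a).
Proof.
move=> ab; rewrite Rintegral_cst//= lebesgue_measure_itv/= lte_fin.
move: ab; rewrite le_eqVlt => /predU1P[->|->]; last by rewrite -EFinD.
by rewrite ltxx subrr.
Qed.

Lemma segintZ a b c f : cont_on a b f ->
  segint a b (fun x => c * f x) = c * segint a b f.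
Proof. by move=> cf; rewrite RintegralZl//; exact: cont_on_integrable. Qed.

Lemma segint_bounds a b f m M : a <= b -> cont_on a b f ->
  (forall x, a <= x <= b -> m <= f x <= M) ->
  m * (b - a) <= segint a b f <= M * (b - a).
Proof.
move=> ab cf mM; rewrite -!segint_cst//; apply/andP; split.
- by apply: segint_le => // [|x xab]; [exact: cont_on_cst | have /andP[] := mM x xab].
- by apply: segint_le => // [|x xab]; [exact: cont_on_cst | have /andP[] := mM x xab].
Qed.

Lemma segint_xx a f : segint a a f = 0.
Proof. by rewrite set_itv1 Rintegral_set1. Qed.

(** This makes pathwise integrals measurable in the sample point, as limits of finite sums. By
    uniform continuity each cell contributes an error proportional to its length, and the errors add
    up by induction over the cells. *)
Lemma segint_riemann a b f : a <= b -> cont_on a b f -> forall e, 0 < e ->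
  exists n0 : nat, forall n : nat, (n0 <= n)%N ->
    `|segint a b f - \sum_(i < n.+1) f (a + (b - a) * i%:R / n.+1%:R) *
       ((b - a) / n.+1%:R)| <= e.
Proof.
move=> ab cf e e0.
(* The [+ 1] keeps the quotient meaningful when [a = b]; the total error [e * (b - a) / (b - a + 1)]
   is still at most [e]. *)
have e'0 : 0 < e / (b - a + 1) by rewrite divr_gt0//; lra.
have [d d0 Hd] := cont_on_unif cf e'0.
exists (Num.truncn ((b - a) / d)) => n n0n.
have n1 : 0 < n.+1%:R :> R by rewrite ltr0n.
have hd : (b - a) / n.+1%:R < d.
  rewrite ltr_pdivrMr// mulrC -ltr_pdivrMr//.
  apply: lt_le_trans (truncnS_gt _) _; by rewrite ler_nat.
set h := (b - a) / n.+1%:R in hd *.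
have h0 : 0 <= h by rewrite divr_ge0// subr_ge0.
have nodeE (i : nat) : a + (b - a) * i%:R / n.+1%:R = a + h * i%:R.
  by rewrite /h; field; rewrite gt_eqF.
have hn : h * n.+1%:R = b - a by rewrite /h; field; rewrite gt_eqF.
have node i : (i <= n.+1)%N -> a <= a + h * i%:R <= b.
  move=> i_n; rewrite lerDl mulr_ge0//=.
  have : h * i%:R <= h * n.+1%:R by rewrite ler_wpM2l// ler_nat.
  by rewrite hn; lra.
suff H (j : nat) : (j <= n.+1)%N ->
    `|segint a (a + h * j%:R) f - \sum_(i < j) f (a + h * i%:R) * h| <=
      e / (b - a + 1) * (h * j%:R).
  have := H n.+1 (leqnn _); rewrite hn.
  have -> : a + (b - a) = b by ring.
  under eq_bigr => i _ do rewrite -nodeE.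
  move=> /le_trans; apply.
  by rewrite mulrAC ler_pdivrMr; nra.
elim: j => [_|j IH jn].
  by rewrite big_ord0 subr0 mulr0 addr0 segint_xx normr0 mulr0.
have /andP[j1 j2] := node j (ltnW jn); have /andP[k1 k2] := node _ jn.
have jk : a + h * j%:R <= a + h * j.+1%:R by rewrite lerD2l ler_wpM2l// ler_nat.
rewrite big_ord_recr/= (@segint_split _ _ (a + h * j%:R)); last 2 first.
  - by rewrite j1.
  - by apply: cont_onS cf.
have := IH (ltnW jn).
have cfj : cont_on (a + h * j%:R) (a + h * j.+1%:R) f by apply: cont_onS cf.
have /(segint_bounds jk cfj) : forall x, a + h * j%:R <= x <= a + h * j.+1%:R ->
    f (a + h * j%:R) - e / (b - a + 1) <= f x <= f (a + h * j%:R) + e / (b - a + 1).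
  move=> x /andP[x1 x2].
  have : `|f (a + h * j%:R) - f x| < e / (b - a + 1).
    apply: Hd; [by apply/andP| by apply/andP; split; lra |].
    by move: x2; rewrite mulrSr mulrDr mulr1 ltr_norml => x2; lra.
  by rewrite ltr_norml => ?; apply/andP; split; lra.
have -> : a + h * j.+1%:R - (a + h * j%:R) = h by rewrite mulrSr; ring.
rewrite [in X in _ -> _ -> _ <= X]mulrSr !ler_norml.
set I1 := segint _ _ _; set I2 := segint _ _ _; set S := \sum_(_ < _) _.
by move=> /andP[u1 u2] /andP[v1 v2]; apply/andP; split; lra.
Qed.

End SegmentIntegral.


(** * The coefficients w, k, r, the barrier and the drift they induce *)

Section Coefficients.
Context {R : realType}.
Implicit Types (s t x y : R).

Lemma expR_lipschitz (M x y : R) : x <= M -> y <= M ->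
  `|expR x - expR y| <= expR M * `|x - y|.
Proof.
wlog xy : x y / x <= y.
  move=> H xM yM; have [xy|/ltW yx] := leP x y; first exact: H.
  by rewrite distrC (distrC x); exact: H.
move=> xM yM; rewrite distrC (distrC x) !ger0_norm ?subr_ge0 ?ler_expR//.
have -> : expR y - expR x = expR y * (1 - expR (x - y)).
  by rewrite mulrBr mulr1 -expRD addrCA subrr addr0.
have h1 := expR_ge1Dx (x - y); have h2 := expR_ge0 y.
have h3 : expR y <= expR M by rewrite ler_expR.
apply: le_trans (_ : expR y * (y - x) <= _); first by rewrite ler_wpM2l//; lra.
by rewrite ler_wpM2r// subr_ge0.
Qed.

Context {T kappa : R} {eta : R -> R}.
Hypothesis T0 : 0 < T.
Hypothesis ceta : cont_on 0 T eta.

Local Notation w := (wfun T kappa eta).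
Local Notation k := (kfun T kappa eta).
Local Notation q := (fun u => w u ^- 2).

(** [1 / w] is [expR (- H)] with [H] the integral over [t, T] of a function bounded by [K]. So [H]
    is [K]-Lipschitz and bounded by [K * T], and the exponential transports both facts. *)
Lemma wfunV_bounds : exists gm gM Lip : R, [/\ 0 < gm, 0 < gM, 0 < Lip,
  (forall t, 0 <= t <= T -> gm <= (w t)^-1 <= gM) &
  (forall s t, 0 <= s <= T -> 0 <= t <= T ->
     `|(w s)^-1 - (w t)^-1| <= Lip * `|s - t|)].
Proof.
have cek : cont_on 0 T (fun s => eta s - kappa).
  by apply: cont_onD => //; exact: cont_on_cst.
have [K K0 HK] := cont_on_bounded cek.
pose H t := segint t T (fun s => eta s - kappa).
have wE t : (w t)^-1 = expR (- H t) by rewrite /wfun expRN.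
have Hle s t : 0 <= s -> s <= t -> t <= T -> `|H s - H t| <= K * `|s - t|.
  move=> s0 st tT.
  have cst : cont_on s T (fun s => eta s - kappa) by apply: cont_onS cek.
  have csit : cont_on s t (fun s => eta s - kappa) by apply: cont_onS cek.
  rewrite /H (@segint_split _ s T t)// ?st// addrK distrC (ger0_norm (_ : 0 <= t - s)).
    have : forall x, s <= x <= t -> - K <= eta x - kappa <= K.
      move=> x /andP[sx xt]; rewrite -ler_norml; apply: HK.
      by apply/andP; split; lra.
    move=> /(segint_bounds st csit) /andP[h1 h2].
    by rewrite ler_norml; apply/andP; split; lra.
  by rewrite subr_ge0.
have HLip s t : 0 <= s <= T -> 0 <= t <= T -> `|H s - H t| <= K * `|s - t|.
  move=> /andP[s0 sT] /andP[t0 tT]; have [st|/ltW ts] := leP s t.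
    exact: Hle.
  by rewrite distrC (distrC s); exact: Hle.
have HB t : 0 <= t <= T -> `|H t| <= K * T.
  move=> tT; have := HLip t T tT; rewrite (ltW T0) lexx => /(_ isT).
  rewrite /H segint_xx subr0 => /le_trans; apply.
  by rewrite ler_wpM2l// ?(ltW K0)// ler_norml; move/andP: tT => [? ?]; lra.
exists (expR (- (K * T))), (expR (K * T)), (expR (K * T) * K).
split; rewrite ?expR_gt0 ?mulr_gt0 ?expR_gt0//.
- move=> t /HB; rewrite wE !ler_expR ler_norml => /andP[h1 h2].
  by apply/andP; split; lra.
- move=> s t sT tT; rewrite (wE s) (wE t).
  apply: le_trans (expR_lipschitz (M := K * T) _ _) _.
  + by have := HB s sT; rewrite ler_norml => /andP[? ?]; lra.
  + by have := HB t tT; rewrite ler_norml => /andP[? ?]; lra.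
  rewrite -mulrA ler_wpM2l ?expR_ge0//.
  by rewrite opprK addrC distrC; exact: HLip.
Qed.

Lemma wfun_gt0 t : 0 < w t. Proof. exact: expR_gt0. Qed.

Lemma cont_on_q : cont_on 0 T q.
Proof.
have [gm [gM [Lip [_ _ _ _ HL]]]] := wfunV_bounds.
have -> : q = fun u => (w u)^-1 * (w u)^-1.
  by apply/funext => u; rewrite expr2 invfM.
by apply: cont_onM; exact: lipschitz_cont_on HL.
Qed.

Lemma q_gt0 t : 0 < w t ^- 2.
Proof. by rewrite invr_gt0 exprn_gt0// wfun_gt0. Qed.

Lemma kfunB s t : 0 <= s -> s <= t -> t <= T -> k t - k s = segint s t q.
Proof.
move=> s0 st tT; rewrite /kfun (@segint_split _ 0 t s) ?s0//.
  by rewrite addrAC subrr add0r.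
by apply: cont_onS cont_on_q.
Qed.

Lemma kfun0 : k 0 = 0. Proof. exact: segint_xx. Qed.

Lemma kfun_bilipschitz : exists m M : R, [/\ 0 < m, 0 < M &
  forall s t, 0 <= s -> s <= t -> t <= T ->
    m * (t - s) <= k t - k s <= M * (t - s)].
Proof.
have [gm [gM [Lip [gm0 gM0 _ gb _]]]] := wfunV_bounds.
exists (gm ^+ 2), (gM ^+ 2); split; rewrite ?exprn_gt0// => s t s0 st tT.
rewrite kfunB//; apply: segint_bounds => //; first by apply: cont_onS cont_on_q.
move=> x /andP[sx xt].
have /andP[h1 h2] := gb x ltac:(apply/andP; split; lra).
rewrite -exprVn !ler_sqr ?nnegrE ?h1 ?h2// ?invr_ge0; try lra.
- exact/ltW/wfun_gt0.
- exact/ltW/wfun_gt0.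
Qed.

Lemma kfun_nd s t : 0 <= s -> s <= t -> t <= T -> k s <= k t.
Proof.
have [m [M [m0 M0 H]]] := kfun_bilipschitz => s0 st tT.
by have /andP[h _] := H _ _ s0 st tT; nra.
Qed.

Lemma cont_on_kfun : cont_on 0 T k.
Proof.
have [m [M [m0 M0 H]]] := kfun_bilipschitz.
apply: (@lipschitz_cont_on _ _ _ _ M).
have Hle s t : 0 <= s -> s <= t -> t <= T -> `|k s - k t| <= M * `|s - t|.
  move=> s0 st tT; have /andP[h1 h2] := H _ _ s0 st tT.
  by rewrite distrC (distrC s) !ger0_norm ?subr_ge0//; nra.
move=> s t /andP[s0 sT] /andP[t0 tT]; have [st|/ltW ts] := leP s t.
  exact: Hle.
by rewrite distrC (distrC s); exact: Hle.
Qed.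

(** [theta] and admissibility are written with [rfun], the drift with [kfun]; this identity lets the
    barrier be written with [kfun] throughout. *)
Lemma rfunB s t : 0 <= s <= T -> 0 <= t <= T ->
  rfun T kappa eta s - rfun T kappa eta t = k t - k s.
Proof.
have rE u : 0 <= u <= T -> rfun T kappa eta u = k T - k u.
  by move=> /andP[u0 uT]; rewrite kfunB.
by move=> sT tT; rewrite !rE//; ring.
Qed.

(* The barrier starts strictly before [delta], as (A1) requires. *)
Lemma admissible_barrier (delta a : R) : 0 <= a -> a < delta -> delta < T ->
  admissible T kappa delta eta (fun t => Num.max (k t - k a) 0).
Proof.
move=> a0 ad dT; split.
  apply/within_contP => x xT e e0; have [d d0 Hd] := cont_on_kfun xT e0.
  exists d => // y yT xy; have := Hd y yT xy; rewrite !ltr_norml.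
  by have [h1|h1] := leP (k x - k a) 0; have [h2|h2] := leP (k y - k a) 0; lra.
split; first by move=> t _; rewrite le_max lexx orbT.
split.
  move=> s t s0 st tT; have := kfun_nd s0 st tT => h.
  rewrite ge_max !le_max lexx orbT andbT; apply/orP; left; lra.
have [m [M [m0 M0 H]]] := kfun_bilipschitz.
exists a; split=> // t t0 at_ tT; rewrite rfunB; last 2 first.
- by apply/andP; split; lra.
- by rewrite t0.
have /andP[h1 _] := H a delta a0 (ltW ad) (ltW dT).
have /andP[h2 _] := H a t a0 (ltW at_) tT.
have p1 : 0 < m * (delta - a) by rewrite mulr_gt0// subr_gt0.
have p2 : 0 < m * (t - a) by rewrite mulr_gt0// subr_gt0.
rewrite gt_max !lt_max; apply/andP; split; apply/orP; left; lra.
Qed.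

(** Since [k a <= k delta], the barrier dominates [k t - k delta], which is the half-width of the
    linear zone of [theta]; only the sign branch remains. *)
Lemma theta_above_barrier (delta a l t x : R) :
  0 <= a -> a < delta -> delta < T -> 0 < l -> 0 <= t <= T ->
  l + Num.max (k t - k a) 0 <= `|x| ->
  theta T kappa delta eta t x = - Num.sg x.
Proof.
move=> a0 ad dT l0 tT xl; rewrite /theta; case: ifPn => //.
rewrite negb_or -!ltNge => /andP[dt].
rewrite rfunB//; last by apply/andP; split; lra.
have h : k a <= k delta by apply: kfun_nd => //; lra.
have : k t - k a <= Num.max (k t - k a) 0 by rewrite le_max lexx.
by lra.
Qed.

Lemma segint_drift_ge (eps u t : R) (Y : R -> R) : 0 <= u -> u <= t -> t <= T ->
  cont_on 0 T Y -> (forall v, u <= v <= t -> Y v <= - (1 - eps)) ->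
  (1 - eps) * (k t - k u) <=
    segint 0 u (fun v => w v ^- 2 * Y v) - segint 0 t (fun v => w v ^- 2 * Y v).
Proof.
move=> u0 ut tT cY Yle.
have cqY : cont_on 0 T (fun v => w v ^- 2 * Y v) := cont_onM cont_on_q cY.
rewrite (@segint_split _ 0 t u) ?u0//; last by apply: cont_onS cqY.
have cq : cont_on u t q by apply: cont_onS cont_on_q.
rewrite opprD addrA subrr add0r lerNr kfunB// -mulNr -segintZ//.
apply: segint_le => //.
- by apply: cont_onS cqY.
- by apply: cont_onM => //; exact: cont_on_cst.
- by move=> x xut; rewrite mulrC ler_wpM2r// ?(ltW (q_gt0 _))//; exact: Yle.
Qed.

(** As [|Y| <= 1], the noiseless part of the path moves no faster than [k]. This supplies the upper
    half of the closeness to [k] and controls the path before it escapes. *)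
Lemma segint_drift_norm (u t : R) (Y : R -> R) : 0 <= u -> u <= t -> t <= T ->
  cont_on 0 T Y -> (forall v, 0 <= v <= T -> -1 <= Y v <= 1) ->
  `|segint 0 u (fun v => w v ^- 2 * Y v) - segint 0 t (fun v => w v ^- 2 * Y v)|
    <= k t - k u.
Proof.
move=> u0 ut tT cY Yle.
have cqY : cont_on 0 T (fun v => w v ^- 2 * Y v) := cont_onM cont_on_q cY.
rewrite (@segint_split _ 0 t u) ?u0//; last by apply: cont_onS cqY.
have cq : cont_on u t q by apply: cont_onS cont_on_q.
have cqYut : cont_on u t (fun v => w v ^- 2 * Y v) by apply: cont_onS cqY.
rewrite opprD addrA subrr add0r normrN kfunB// ler_norml.
rewrite -(mulN1r (segint u t q)) -segintZ//.
apply/andP; split; apply: segint_le => //.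
- by apply: cont_onM => //; exact: cont_on_cst.
- move=> x /andP[ux xt]; have /andP[h _] := Yle x ltac:(apply/andP; split; lra).
  by rewrite mulrC ler_wpM2l// ?(ltW (q_gt0 _)).
- move=> x /andP[ux xt]; have /andP[_ h] := Yle x ltac:(apply/andP; split; lra).
  by rewrite ler_piMr// ?(ltW (q_gt0 _)).
Qed.

End Coefficients.


(** * Probabilities as real numbers *)

Section RealProbability.
Context {d : measure_display} {T : measurableType d} {R : realType}.
Variable P : probability T R.
Implicit Types (A B : set T) (c : R).

Definition pr A : R := fine (P A).

Lemma prE A : measurable A -> P A = (pr A)%:E.
Proof. by move=> mA; rewrite /pr fineK// fin_num_measure. Qed.

Lemma pr_ge0 A : 0 <= pr A.
Proof. by rewrite /pr fine_ge0. Qed.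

Lemma le_pr A B : measurable A -> measurable B -> A `<=` B -> pr A <= pr B.
Proof.
move=> mA mB AB; rewrite -lee_fin -!prE//.
by apply: le_measure => //; rewrite inE.
Qed.

Lemma prT : pr setT = 1.
Proof. by rewrite /pr probability_setT. Qed.

Lemma pr_le1 A : measurable A -> pr A <= 1.
Proof. by move=> mA; rewrite -prT; exact: le_pr. Qed.

Lemma pr0 : pr set0 = 0.
Proof. by rewrite /pr measure0. Qed.

Lemma pr_setU A B : measurable A -> measurable B -> A `&` B = set0 ->
  pr (A `|` B) = pr A + pr B.
Proof.
move=> mA mB AB0; apply: EFin_inj; rewrite EFinD -!prE ?measureU//.
exact: measurableU.
Qed.

Lemma pr_setU_le A B : measurable A -> measurable B ->
  pr (A `|` B) <= pr A + pr B.
Proof.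
move=> mA mB; rewrite -lee_fin EFinD -!prE//; last exact: measurableU.
exact: measureU2.
Qed.

Lemma pr_setI_D A B : measurable A -> measurable B ->
  pr A = pr (A `&` B) + pr (A `\` B).
Proof.
move=> mA mB; rewrite -pr_setU ?setUIDK//.
- exact: measurableI.
- exact: measurableD.
- by rewrite setDE setIACA setICr setI0.
Qed.

(** Continuity from below: bounds uniform in a finite grid survive the passage to all dyadic
    times. *)
Lemma pr_bigcup_le (F : nat -> set T) c :
  (forall n, measurable (F n)) -> {homo F : n m / (n <= m)%N >-> n `<=` m} ->
  (forall n, pr (F n) <= c) -> pr (\bigcup_n F n) <= c.
Proof.
move=> mF ndF Fc.
have mU : measurable (\bigcup_n F n) by exact: bigcupT_measurable.
have h : P \o F @ \oo --> P (\bigcup_n F n).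
  by apply: nondecreasing_cvg_mu => // n m nm; apply/subsetPset; exact: ndF.
rewrite -lee_fin -prE//; apply: (cvge_to_le h).
by apply: nearW => n /=; rewrite prE// lee_fin.
Qed.

Lemma pr_bigsetU_le (I : Type) (r : seq I) (F : I -> set T) :
  (forall i, measurable (F i)) ->
  pr (\big[setU/set0]_(i <- r) F i) <= \sum_(i <- r) pr (F i).
Proof.
move=> mF; elim: r => [|i r IH]; first by rewrite !big_nil pr0.
rewrite !big_cons; apply: le_trans (pr_setU_le _ _) _ => //.
  exact: bigsetU_measurable.
by rewrite lerD2l.
Qed.

End RealProbability.

(** * Upper and lower bounds for Gaussian tails *)

Section GaussianTail.
Context {R : realType}.
Implicit Types (s x m : R) (U : set R).

(* Tilting: on U, the centred density is at most exp (- x^2 / (2 s^2)) times the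
   density centred at m = x or m = - x. *)
Lemma normal_prob_tilt s m U : 0 < s -> measurable U ->
  (forall y, U y -> m ^+ 2 <= m * y) ->
  (normal_prob 0 s U <= (expR (- (m ^+ 2 / (s ^+ 2 *+ 2))))%:E)%E.
Proof.
move=> s0 mU Um; have sn0 : s != 0 by rewrite gt_eqF.
have s2 : 0 < s ^+ 2 *+ 2 by rewrite pmulrn_lgt0// exprn_gt0.
set c := expR _.
apply: (@le_trans _ _ (\int[lebesgue_measure]_(y in U) (c%:E * (normal_pdf m s y)%:E))%E).
  apply: ge0_le_integral => //.
  - by move=> y _; rewrite lee_fin normal_pdf_ge0.
  - by apply/measurable_EFinP; apply: measurable_funTS; exact: measurable_normal_pdf.
  - apply: measurable_funeM; apply/measurable_EFinP; apply: measurable_funTS.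
    exact: measurable_normal_pdf.
  move=> y Uy; rewrite -EFinM lee_fin !normal_pdfE// mulrCA.
  rewrite ler_wpM2l ?normal_peak_ge0// /normal_fun /c -expRD ler_expR subr0.
  have iv0 : 0 <= (s ^+ 2 *+ 2)^-1 by rewrite invr_ge0 ltW.
  have my0 : 0 <= m * y - m ^+ 2 by rewrite subr_ge0; exact: Um.
  by have := mulr_ge0 iv0 my0; nra.
rewrite ge0_integralZl//.
- rewrite -[leRHS]mule1 lee_wpmul2l//; first by rewrite lee_fin expR_ge0.
  exact: (probability_le1 (normal_prob m s) mU).
- by apply/measurable_EFinP; apply: measurable_funTS; exact: measurable_normal_pdf.
- by move=> y _; rewrite lee_fin normal_pdf_ge0.
- by rewrite lee_fin expR_ge0.
Qed.

Lemma expRN_le_inv x : 0 < x -> expR (- x) <= x^-1.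
Proof.
move=> x0; rewrite expRN lef_pV2 ?posrE ?expR_gt0//.
by have := expR_ge1Dx x; lra.
Qed.

Lemma measurable_normr_gt x : measurable [set y : R | x < `|y|].
Proof.
have -> : [set y : R | x < `|y|] = (@normr R R) @^-1` `]x, +oo[.
  by apply/seteqP; split => y /=; rewrite in_itv/= andbT.
rewrite -[X in measurable X]setTI.
exact: normr_measurable.
Qed.

(** Each of the two half-lines is tilted to its own endpoint, and [expR (- z) <= z^-1] turns the
    exponential into a bound of Chebyshev type; polynomial decay is enough for the sums over
    blocks. *)
Lemma normal_prob_tail s x : 0 < s -> 0 < x ->
  (normal_prob 0 s [set y | x < `|y|]%R <= (4 * s ^+ 2 / x ^+ 2)%:E)%E.
Proof.
move=> s0 x0.
have -> : [set y | x < `|y|] = `]x, +oo[ `|` `]-oo, - x[ :> set R.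
  apply/seteqP; split => y /=; rewrite !in_itv/= andbT lter_normr.
    by move=> /orP[|]; [left|right]; lra.
  by move=> h; apply/orP; move: h => [|]; [left|right]; lra.
have h (m : R) (U : set R) : m ^+ 2 = x ^+ 2 -> measurable U ->
    (forall y, U y -> m ^+ 2 <= m * y) ->
    (normal_prob 0 s U <= (2 * s ^+ 2 / x ^+ 2)%:E)%E.
  move=> mx mU Um; apply: le_trans (normal_prob_tilt s0 mU Um) _.
  rewrite lee_fin mx; apply: le_trans (expRN_le_inv _) _.
    by rewrite divr_gt0// ?exprn_gt0// pmulrn_lgt0// exprn_gt0.
  by rewrite invf_div mulr_natl.
apply: le_trans (measureU2 _ _ _) _ => //.
have -> : 4 * s ^+ 2 / x ^+ 2 = 2 * s ^+ 2 / x ^+ 2 + 2 * s ^+ 2 / x ^+ 2.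
  by field; rewrite gt_eqF.
rewrite EFinD; apply: leeD.
  by apply: (h x) => // y /=; rewrite in_itv/= andbT => xy; nra.
by apply: (h (- x)); rewrite ?sqrrN// => y /=; rewrite in_itv/= => xy; nra.
Qed.

(** The interval from [x] to [x + s] already has this mass: its length [s] times the density at its
    right end, where the density is smallest. *)
Lemma normal_prob_gt_lb s x : 0 < s -> 0 <= x ->
  (((Num.sqrt (pi *+ 2))^-1 * expR (- ((x / s + 1) ^+ 2 / 2)))%:E
    <= normal_prob 0 s `]x, +oo[)%E.
Proof.
move=> s0 x0; have sn0 : s != 0 by rewrite gt_eqF.
have s2 : 0 < s ^+ 2 *+ 2 by rewrite pmulrn_lgt0// exprn_gt0.
pose c : R := (Num.sqrt (pi *+ 2))^-1 * expR (- ((x / s + 1) ^+ 2 / 2)).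
rewrite -/c.
apply: (@le_trans _ _ (\int[lebesgue_measure]_(y in [set` `]x, (x + s)%R]]) (c / s)%:E)%E).
  rewrite integral_cst//= lebesgue_measure_itv/= lte_fin ltrDl s0 -EFinD -EFinM.
  by rewrite lee_fin addrAC subrr add0r divfK.
apply: (@le_trans _ _ (normal_prob 0 s `]x, x + s])); last first.
  apply: le_measure; rewrite ?inE//.
  by move=> y /=; rewrite !in_itv/= andbT => /andP[].
apply: ge0_le_integral => //.
- move=> y _; rewrite lee_fin divr_ge0// ?(ltW s0)// mulr_ge0 ?expR_ge0// invr_ge0.
- by apply/measurable_EFinP; apply: measurable_funTS; exact: measurable_normal_pdf.
move=> y /=; rewrite in_itv/= => /andP[xy yxs].
rewrite lee_fin normal_pdfE// /c /normal_fun subr0 mulrAC.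
have -> : (Num.sqrt (pi *+ 2))^-1 / s = normal_peak s.
  rewrite /normal_peak -mulrnAr sqrtrM ?sqr_ge0// sqrtr_sqr gtr0_norm// invfM mulrC//.
rewrite ler_wpM2l ?normal_peak_ge0// ler_expR mulNr lerN2.
have -> : (x / s + 1) ^+ 2 / 2 = (x + s) ^+ 2 / (s ^+ 2 *+ 2).
  by rewrite -mulr_natr; field.
rewrite ler_pM2r ?invr_gt0// ler_sqr ?nnegrE; lra.
Qed.

End GaussianTail.


(** * Events and variables measurable for a member of the filtration *)

Section SubSigmaAlgebra.
Context {d : measure_display} {Omega : measurableType d} {R : realType}.
Variable G : set (set Omega).
Hypothesis sG : sigma_algebra setT G.

Lemma salgC A : G A -> G (~` A).
Proof. by case: sG => _ H _ GA; rewrite -setTD; exact: H. Qed.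

Lemma salg_bigcup (A : nat -> set Omega) : (forall n, G (A n)) -> G (\bigcup_n A n).
Proof. by case: sG => _ _; apply. Qed.

Lemma salgU A B : G A -> G B -> G (A `|` B).
Proof.
move=> GA GB; rewrite -bigcup2E; apply: salg_bigcup => -[|[|n]]//=.
by case: sG.
Qed.

Lemma salgI A B : G A -> G B -> G (A `&` B).
Proof.
by move=> GA GB; rewrite -(setCK (A `&` B)) setCI; apply/salgC/salgU; exact: salgC.
Qed.

Lemma salgD A B : G A -> G B -> G (A `\` B).
Proof. by move=> GA GB; rewrite setDE; apply: salgI => //; exact: salgC. Qed.

Lemma salg_bigsetU n (A : nat -> set Omega) :
  (forall i, (i < n)%N -> G (A i)) -> G (\big[setU/set0]_(i < n) A i).
Proof.
elim: n => [|n IH] GA; first by rewrite big_ord0; case: sG.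
rewrite big_ord_recr/=; apply: salgU; last exact: GA.
by apply: IH => i i_n; apply: GA; rewrite ltnW.
Qed.

Definition meas_wrt (X : Omega -> R) := forall U, measurable U -> G (X @^-1` U).

(** A member of the filtration is a bare family of sets; viewing it as a measurable type gives
    access to the closure of measurable functions under differences and norms. *)
Lemma meas_wrtP (X : Omega -> R) :
  meas_wrt X <-> measurable_fun (T := g_sigma_algebraType G) setT X.
Proof.
split=> [GX _ U mU|mX U mU].
  by rewrite setTI; apply: sub_sigma_algebra; exact: GX.
have := mX measurableT U mU; rewrite setTI /measurable/= sigma_algebra_id//.
Qed.

Lemma meas_wrtB X Y : meas_wrt X -> meas_wrt Y -> meas_wrt (fun w => X w - Y w).
Proof. by move=> /meas_wrtP mX /meas_wrtP mY; apply/meas_wrtP; exact: measurable_funB. Qed.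

Lemma meas_wrt_gt X (x : R) : meas_wrt X -> G [set w | x < X w].
Proof.
move=> GX; have -> : [set w | x < X w] = X @^-1` `]x, +oo[.
  by apply/seteqP; split => w /=; rewrite in_itv/= andbT.
exact: GX.
Qed.

Lemma meas_wrt_norm X : meas_wrt X -> meas_wrt (fun w => `|X w|).
Proof.
move=> /meas_wrtP mX; apply/meas_wrtP.
by apply: (@measurableT_comp _ _ _ _ _ _ (@normr R R)) => //; exact: normr_measurable.
Qed.

Lemma meas_wrt_norm_gt X (x : R) : meas_wrt X -> G [set w | x < `|X w|].
Proof. by move=> /meas_wrt_norm/meas_wrt_gt; apply. Qed.

End SubSigmaAlgebra.

(** * A maximal inequality for Brownian increments *)

Section BrownianMaximal.
Context {d : measure_display} {Omega : measurableType d} {R : realType}.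
Context {T : R} {P : probability Omega R} {Fil : R -> set (set Omega)}.
Context {B : R -> Omega -> R}.
Hypothesis HF : filtration Fil.
Hypothesis HB : brownian T P Fil B.
Implicit Types (s t x y u : R) (A : set Omega).

Lemma fil_salg t : sigma_algebra setT (Fil t).
Proof. by case: HF. Qed.

Lemma fil_measurable t A : Fil t A -> measurable A.
Proof. by case: HF => _ [H _]; exact: H. Qed.

Lemma filS s t A : s <= t -> Fil s A -> Fil t A.
Proof. by case: HF => _ [_ H] st; exact: H. Qed.

Lemma meas_wrt_filS (X : Omega -> R) s t : s <= t ->
  meas_wrt (Fil s) X -> meas_wrt (Fil t) X.
Proof. by move=> st mX U mU; apply: filS st _; exact: mX. Qed.

Lemma brownian_meas t u : 0 <= t <= T -> t <= u -> meas_wrt (Fil u) (B t).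
Proof.
by case: HB => aB _ tT tu; apply: meas_wrt_filS tu _ => U mU; exact: aB.
Qed.

Lemma incr_norm_gt_fil s t u x : 0 <= s <= T -> 0 <= t <= T -> s <= u -> t <= u ->
  Fil u [set w | x < `|B t w - B s w|].
Proof.
move=> sT tT su tu; apply: meas_wrt_norm_gt; first exact: fil_salg.
by apply: meas_wrtB; [exact: fil_salg | exact: brownian_meas | exact: brownian_meas].
Qed.

Lemma pr_incr s t A (U : set R) : 0 <= s -> s < t -> t <= T -> Fil s A ->
  measurable U -> pr P (A `&` [set w | U (B t w - B s w)]) =
    pr P A * fine (normal_prob 0 (Num.sqrt (t - s)) U).
Proof.
move=> s0 st tT FA mU; have [_ [_ H]] := HB.
rewrite /pr (H s t s0 st tT A U FA mU) fineM// fin_num_measure//.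
exact: fil_measurable FA.
Qed.

Lemma pr_incr_tail s t A x : 0 <= s -> s < t -> t <= T -> Fil s A -> 0 < x ->
  pr P (A `&` [set w | x < `|B t w - B s w|]) <= pr P A * (4 * (t - s) / x ^+ 2).
Proof.
move=> s0 st tT FA x0.
rewrite (@pr_incr s t A [set y | x < `|y|])//; last exact: measurable_normr_gt.
rewrite ler_wpM2l ?pr_ge0// -lee_fin fineK; last first.
  by rewrite fin_num_measure//; exact: measurable_normr_gt.
apply: le_trans (normal_prob_tail _ x0) _; first by rewrite sqrtr_gt0 subr_gt0.
by rewrite sqr_sqrtr// subr_ge0 ltW.
Qed.

Lemma pr_incr_gt_lb s t A x : 0 <= s -> s < t -> t <= T -> Fil s A -> 0 <= x ->
  pr P A * ((Num.sqrt (pi *+ 2))^-1 *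
            expR (- ((x / Num.sqrt (t - s) + 1) ^+ 2 / 2))) <=
  pr P (A `&` [set w | x < B t w - B s w]).
Proof.
move=> s0 st tT FA x0.
have -> : [set w | x < B t w - B s w] = [set w | `]x, +oo[%classic (B t w - B s w)].
  by apply/seteqP; split => w /=; rewrite in_itv/= andbT.
rewrite pr_incr// ler_wpM2l ?pr_ge0// -lee_fin fineK ?fin_num_measure//.
by apply: normal_prob_gt_lb => //; rewrite sqrtr_gt0 subr_gt0.
Qed.

Definition node s t (n i : nat) : R := s + (t - s) * (i%:R / n%:R).

Lemma node_itv s t n i : s <= t -> (i <= n)%N -> s <= node s t n i <= t.
Proof.
move=> st i_n; rewrite /node.
have h1 : 0 <= (i%:R / n%:R : R) by rewrite divr_ge0.
have h2 : (i%:R / n%:R : R) <= 1.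
  have [->|n0] := posnP n; first by rewrite invr0 mulr0.
  by rewrite ler_pdivrMr ?ltr0n// mul1r ler_nat.
by apply/andP; split; nra.
Qed.

Definition grid_exceed s t y n : set Omega :=
  \big[setU/set0]_(i < n.+1) [set w | y < `|B (node s t n i) w - B s w|].

Lemma grid_exceedP s t y n w : grid_exceed s t y n w <->
  exists2 i, (i <= n)%N & y < `|B (node s t n i) w - B s w|.
Proof.
by rewrite /grid_exceed -(bigcup_mkord _
  (fun i => [set w | y < `|B (node s t n i) w - B s w|])); split => -[i]; exists i.
Qed.

(* Ottaviani: once |B - B_s| has exceeded 2x, an independent later increment of
   size at most x keeps |B_t - B_s| above x; it is that small with probability
   at least 1/2 unless 8 (t - s) > x^2, when the bound is trivial. *)
Lemma pr_grid_exceed s t A x n : 0 <= s -> s < t -> t <= T -> Fil s A -> 0 < x ->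
  pr P (A `&` grid_exceed s t (2 * x) n) <= pr P A * (8 * (t - s) / x ^+ 2).
Proof.
move=> s0 st tT FA x0.
have x2 : 0 < x ^+ 2 by rewrite exprn_gt0.
have mA := fil_measurable FA.
have nodeT i : (i <= n)%N -> 0 <= node s t n i <= T.
  by move=> i_n; have /andP[h1 h2] := node_itv (ltW st) i_n; apply/andP; split; lra.
have sT : 0 <= s <= T by apply/andP; split; lra.
have t0T : 0 <= t <= T by apply/andP; split; lra.
pose S i := [set w | 2 * x < `|B (node s t n i) w - B s w|].
pose E := [set w | x < `|B t w - B s w|].
have mE : measurable E by apply: (@fil_measurable t); apply: incr_norm_gt_fil => //; exact: ltW.
have node_mono i j : (i <= j)%N -> node s t n i <= node s t n j.
  move=> ij; rewrite /node lerD2l ler_wpM2l ?subr_ge0 ?(ltW st)//.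
  by rewrite ler_wpM2r ?invr_ge0// ler_nat.
have FS i j : (i <= j)%N -> (j <= n)%N -> Fil (node s t n j) (S i).
  move=> ij jn; apply: incr_norm_gt_fil => //.
  - exact: nodeT (leq_trans ij jn).
  - by case/andP: (node_itv (ltW st) jn).
  - exact: node_mono.
have FU j m : (m <= j.+1)%N -> (j <= n)%N -> Fil (node s t n j) (\big[setU/set0]_(i < m) S i).
  move=> mj jn; apply: salg_bigsetU; first exact: fil_salg.
  by move=> i im; apply: FS => //; have := leq_trans im mj.
have [small|big] := leP (8 * (t - s) / x ^+ 2) 1; last first.
  apply: (@le_trans _ _ (pr P A)); last by rewrite ler_peMr ?pr_ge0// ltW.
  apply: le_pr => //.
  apply: measurableI => //; apply: (@fil_measurable (node s t n n)).
  exact: FU.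
have small' : 8 * (t - s) <= x ^+ 2 by move: small; rewrite ler_pdivrMr// mul1r.
(* Induction along the grid, splitting by the first node that exceeds [2 * x]. The new piece [D]
   belongs to the past of its node, so the later increment is independent of it and at least half of
   [D] remains in [E]. *)
have H m : (m <= n.+1)%N -> pr P (A `&` \big[setU/set0]_(i < m) S i) <=
    2 * pr P (A `&` \big[setU/set0]_(i < m) S i `&` E).
  elim: m => [_|m IH mn]; first by rewrite big_ord0 setI0 set0I pr0 mulr0.
  rewrite big_ord_recr/=; set U := \big[setU/set0]_(i < m) S i.
  have mn' : (m <= n)%N by [].
  have FUm : Fil (node s t n m) U by apply: FU => //; exact: leqnSn.
  have FSm := FS m m (leqnn _) mn'.
  pose D := A `&` (S m `\` U).
  have FD : Fil (node s t n m) D.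
    apply: salgI; [exact: fil_salg| |].
      by apply: filS FA; case/andP: (node_itv (ltW st) mn').
    by apply: salgD => //; exact: fil_salg.
  have mD := fil_measurable FD; have mU := fil_measurable FUm.
  have -> : A `&` (U `|` S m) = (A `&` U) `|` D.
    by rewrite /D -setIUr setDE setUIr setUCr setIT.
  have AUD : (A `&` U) `&` D = set0.
    by apply/seteqP; split => // w [[_ Uw] [_ [_ nUw]]].
  rewrite setIUl pr_setU//; last exact: measurableI.
  rewrite pr_setU; [|by apply: measurableI => //; exact: measurableI
    |exact: measurableI|by rewrite setIACA AUD set0I].
  rewrite mulrDr; apply: lerD; first by apply: IH; exact: ltnW.
  have DS w : D w -> 2 * x < `|B (node s t n m) w - B s w| by case=> _ [].
  (* If the node is [t] itself no increment is left to draw, and [D] lies in [E] outright. *)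
  have /andP[_] := node_itv (ltW st) mn'; rewrite le_eqVlt => /predU1P[ut|ut].
    have -> : D `&` E = D.
      apply/setIidPl => w /DS; rewrite ut /E/=; lra.
    by have := pr_ge0 P D; lra.
  have /andP[u0 uT] := nodeT m mn'.
  have su : s <= node s t n m by case/andP: (node_itv (ltW st) mn').
  pose F := [set w | x < `|B t w - B (node s t n m) w|].
  have mF : measurable F.
    apply: (@fil_measurable t); apply: incr_norm_gt_fil => //; [exact: nodeT | exact: ltW].
  have := pr_incr_tail u0 ut tT FD x0; rewrite -/F.
  have : 4 * (t - node s t n m) / x ^+ 2 <= 1 / 2 by rewrite ler_pdivrMr//; lra.
  have := pr_ge0 P D; have := pr_setI_D P mD mF.
  have : pr P (D `\` F) <= pr P (D `&` E).
    apply: le_pr; [exact: measurableD | exact: measurableI |].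
    move=> w [Dw /negP]; rewrite -leNgt => Fw; split => //.
    have := DS w Dw; rewrite /E/=.
    have -> : B t w - B s w = (B (node s t n m) w - B s w) + (B t w - B (node s t n m) w) by ring.
    have := lerB_normD (B (node s t n m) w - B s w) (B t w - B (node s t n m) w).
    by move: Fw; lra.
  set p := 4 * _ / _; move=> h1 h2 h3 h4 h5.
  have : pr P D * p <= pr P D * (1 / 2) by rewrite ler_wpM2l.
  by lra.
apply: le_trans (H n.+1 (leqnn _)) _.
apply: (@le_trans _ _ (2 * pr P (A `&` E))).
  rewrite ler_wpM2l//; apply: le_pr.
  - apply: measurableI => //; apply: measurableI => //.
    by apply: (@fil_measurable (node s t n n)); exact: FU.
  - exact: measurableI.
  - by move=> w [[]].
have := pr_incr_tail s0 st tT FA x0; rewrite -/E => h.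
apply: (@le_trans _ _ (2 * (pr P A * (4 * (t - s) / x ^+ 2)))); first by rewrite ler_wpM2l.
by rewrite mulrCA ler_wpM2l ?pr_ge0// !mulrA; lra.
Qed.

Lemma grid_exceed_fil s t y n : 0 <= s -> s <= t -> t <= T ->
  Fil t (grid_exceed s t y n).
Proof.
move=> s0 st tT.
apply: (@salg_bigsetU _ _ _ (fil_salg t) _
  (fun i => [set w | y < `|B (node s t n i) w - B s w|])) => i i_n.
have /andP[h1 h2] := node_itv st (i_n : (i <= n)%N).
by apply: incr_norm_gt_fil => //; apply/andP; split; lra.
Qed.

(** Restricting to dyadic nodes keeps this event in [Fil t], although the paths of [B] are
    continuous only almost surely. Powers of two make the grids nested, hence the union
    increasing. *)
Definition exceed s t y : set Omega := \bigcup_n grid_exceed s t y (2 ^ n).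

Lemma exceed_fil s t y : 0 <= s -> s <= t -> t <= T -> Fil t (exceed s t y).
Proof.
move=> s0 st tT; apply: salg_bigcup => [|n]; first exact: fil_salg.
exact: grid_exceed_fil.
Qed.

(** The grid bound at [x = y / 2] is uniform in the grid; its constant 8 becomes 32 through the
    square of [y / 2]. *)
Lemma pr_exceed s t A y : 0 <= s -> s <= t -> t <= T -> Fil s A -> 0 < y ->
  pr P (A `&` exceed s t y) <= pr P A * (32 * (t - s) / y ^+ 2).
Proof.
move=> s0; rewrite le_eqVlt => /predU1P[<-|st] tT FA y0.
  rewrite [exceed _ _ _](_ : _ = set0); last first.
    apply/seteqP; split => // w [n _ /grid_exceedP[i _]]; rewrite /node subrr mul0r addr0 subrr normr0; lra.
  by rewrite setI0 pr0 mulr_ge0 ?pr_ge0// subrr mulr0 mul0r.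
have mA := fil_measurable FA.
have mG n : measurable (grid_exceed s t y n).
  by apply: (@fil_measurable t); apply: grid_exceed_fil => //; exact: ltW.
rewrite /exceed setI_bigcupr; apply: pr_bigcup_le.
- by move=> n; exact: measurableI.
- apply: homo_leq => [n w //|n m p h1 h2|n]; first exact: subset_trans h1 h2.
  apply: setIS => w /grid_exceedP[i i_n yB]; apply/grid_exceedP; exists (2 * i)%N.
    by rewrite expnS leq_mul2l.
  have -> : node s t (2 ^ n.+1) (2 * i) = node s t (2 ^ n) i => //.
  by rewrite /node expnS !natrM; field; rewrite natrX expf_neq0.
- move=> n; have -> : y = 2 * (y / 2) by lra.
  apply: le_trans (pr_grid_exceed _ s0 st tT FA _) _; first lra.
  rewrite ler_wpM2l ?pr_ge0// le_eqVlt; apply/orP; left; apply/eqP.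
  by field; rewrite gt_eqF.
Qed.

(* The dyadic grid is dense, so path continuity upgrades the grid bound. *)
Lemma not_exceed_le s t y w : s <= t -> cont_on s t (fun u => B u w) ->
  ~ exceed s t y w -> forall u, s <= u <= t -> `|B u w - B s w| <= y.
Proof.
rewrite le_eqVlt => /predU1P[<-|st] cB nE u sut.
  rewrite leNgt; apply/negP => h; apply: nE; exists 0%N => //.
  apply/grid_exceedP; exists 0%N => //; rewrite /node subrr mul0r addr0.
  by have us : u = s; [apply/eqP; rewrite eq_le andbC | rewrite us in h].
rewrite leNgt; apply/negP => h.
have [|e e0 He] := cB u sut (`|B u w - B s w| - y); first by rewrite subr_gt0.
pose n := Num.truncn ((t - s) / e).
have ne : (t - s) / (2 ^ n)%N%:R < e.
  rewrite ltr_pdivrMr ?ltr0n ?expn_gt0// mulrC -ltr_pdivrMr//.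
  apply: lt_le_trans (truncnS_gt _) _; rewrite ler_nat; exact: ltn_expl.
pose z := (u - s) / (t - s) * (2 ^ n)%N%:R.
have z0 : 0 <= z by case/andP: sut => ? ?; rewrite mulr_ge0// divr_ge0//; lra.
pose i := Num.truncn z.
have /andP[i1 i2] : i%:R <= z < i.+1%:R by exact: truncn_itv z0.
have zE : s + (t - s) * (z / (2 ^ n)%N%:R) = u.
  have n2 : (2 ^ n)%N%:R != 0 :> R by rewrite pnatr_eq0 -lt0n expn_gt0.
  have ts : t - s != 0 by rewrite subr_eq0 gt_eqF.
  by rewrite /z; field; rewrite n2 ts.
have nu : node s t (2 ^ n) i <= u < node s t (2 ^ n) i + (t - s) / (2 ^ n)%N%:R.
  rewrite /node -zE; apply/andP; split.
    by rewrite lerD2l ler_wpM2l ?subr_ge0 ?(ltW st)// ler_wpM2r// invr_ge0.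
  rewrite -addrA ltrD2l -mulrDr ltr_pM2l ?subr_gt0// -[X in _ + X]mul1r -mulrDl.
  by rewrite ltr_pM2r ?invr_gt0 ?ltr0n ?expn_gt0// natr1.
have i_n : (i <= 2 ^ n)%N.
  rewrite -(ler_nat R); apply: le_trans i1 _; rewrite /z ler_piMl//.
  by case/andP: sut => ? ?; rewrite ler_pdivrMr ?subr_gt0//; lra.
apply: nE; exists n => //; apply/grid_exceedP; exists i => //.
have := He _ (node_itv (ltW st) i_n).
rewrite (_ : `|u - _| < e); last by case/andP: nu => ? ?; rewrite ltr_norml; apply/andP; split; lra.
move=> /(_ isT).
have := lerB_dist (B u w - B s w) (B (node s t (2 ^ n) i) w - B s w).
have -> : B u w - B s w - (B (node s t (2 ^ n) i) w - B s w) = B u w - B (node s t (2 ^ n) i) w by ring.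
lra.
Qed.

End BrownianMaximal.


(** * Pathwise control of the stochastic integral by the oscillation of B *)

Section WienerIntegralPaths.
Context {R : realType}.

Lemma le_of_le_epsilon (x y : R) : (forall j : nat, x <= y + j.+1%:R^-1) -> x <= y.
Proof.
move=> h; rewrite leNgt; apply/negP => yx.
have d0 : 0 < (x - y)^-1 by rewrite invr_gt0 subr_gt0.
have := h (Num.truncn (x - y)^-1).
have := truncnS_gt (x - y)^-1; set m := _.+1.
move=> h1; have m0 : (0 : R) < m%:R by rewrite ltr0n.
have : m%:R^-1 < x - y by rewrite -[X in _ < X]invrK ltf_pV2 ?posrE.
lra.
Qed.

Lemma abel_bound (f g : nat -> R) (a b : nat) (lam x : R) : (a <= b)%N -> 0 <= lam ->
  (forall i, (a <= i < b)%N -> `|g i.+1 - g i| <= lam) ->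
  (forall i, (a <= i <= b)%N -> `|f i - f a| <= x) ->
  `|\sum_(a <= i < b) g i * (f i.+1 - f i) - g b * (f b - f a)| <=
    lam * (b - a)%N%:R * x.
Proof.
move=> ab lam0; have [n ->] : exists n, b = (a + n)%N by exists (b - a)%N; rewrite subnKC.
rewrite addKn; elim: n {b ab} => [|n IH] hg hf.
  by rewrite addn0 big_geq// subrr mulr0 subr0 normr0 mulr0 mul0r.
have h1 i : (a <= i < a + n)%N -> (a <= i < a + n.+1)%N by case/andP => -> /= h; rewrite addnS ltnS ltnW.
have h2 i : (a <= i <= a + n)%N -> (a <= i <= a + n.+1)%N by case/andP => -> /= h; rewrite addnS ltnW.
have {}IH := IH (fun i h => hg i (h1 i h)) (fun i h => hf i (h2 i h)).
rewrite addnS big_nat_recr/= ?leq_addr//.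
set S := \sum_(_ <= _ < _) _ in IH *.
have -> : S + g (a + n)%N * (f (a + n).+1 - f (a + n)%N) - g (a + n).+1 * (f (a + n).+1 - f a) =
  (S - g (a + n)%N * (f (a + n)%N - f a)) - (g (a + n).+1 - g (a + n)%N) * (f (a + n).+1 - f a).
  by ring.
apply: le_trans (ler_normB _ _) _.
have -> : lam * n.+1%:R * x = lam * n%:R * x + lam * x by rewrite -natr1; ring.
apply: lerD => //; rewrite normrM.
have g1 := hg (a + n)%N; have f1 := hf (a + n).+1.
apply: ler_pM => //; first by apply: g1; rewrite leq_addr addnS leqnn.
by apply: f1; rewrite addnS leqnn andbT -addnS leq_addr.
Qed.

Context {d : measure_display} {Omega : measurableType d}.
Context {T sigma Lip : R} {P : probability Omega R}.
Context {Fil : R -> set (set Omega)} {g q : R -> R} {B mu Y : R -> Omega -> R}.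
Hypothesis T0 : 0 < T.
Hypothesis sigma0 : 0 < sigma.
Hypothesis Lip0 : 0 < Lip.
Hypothesis gLip : forall s t, 0 <= s <= T -> 0 <= t <= T -> `|g s - g t| <= Lip * `|s - t|.
Hypothesis cq : cont_on 0 T q.
Hypothesis HF : filtration Fil.
Hypothesis HB : brownian T P Fil B.
Hypothesis amu : adapted T Fil mu.
Hypothesis aY : adapted T Fil Y.
Hypothesis cmu : forall w, cont_on 0 T (fun t => mu t w).
Hypothesis cY : forall w, cont_on 0 T (fun t => Y t w).

Let N (t : R) (w : Omega) : R := mu t w + segint 0 t (fun u => q u * Y u w).

Hypothesis cvgN : forall t, 0 <= t <= T ->
  cvg_in_prob P (fun n w => sigma * riemann_dB g B t n w) (N t).

Lemma adapted_measurable (X : R -> Omega -> R) t : adapted T Fil X ->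
  0 <= t <= T -> measurable_fun setT (X t).
Proof.
move=> aX tT _ U mU; rewrite setTI.
by apply: (fil_measurable HF (t := t)); exact: aX.
Qed.

Lemma noise_measurable t : 0 <= t <= T -> measurable_fun setT (N t).
Proof.
move=> tT; have /andP[t0 tT'] := tT.
apply: measurable_funD; first exact: adapted_measurable.
pose h (n : nat) w := \sum_(i < n.+1) (q (0 + (t - 0) * i%:R / n.+1%:R) *
  Y (0 + (t - 0) * i%:R / n.+1%:R) w) * ((t - 0) / n.+1%:R).
apply: (@measurable_fun_cvg _ _ _ _ h).
  move=> n; apply: (@measurable_sum _ _ _ _ _ _ (fun (i : 'I_n.+1) w =>
    (q (0 + (t - 0) * i%:R / n.+1%:R) * Y (0 + (t - 0) * i%:R / n.+1%:R) w) * ((t - 0) / n.+1%:R))) => i.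
  apply: measurable_funM => //; apply: measurable_funM => //.
  apply: adapted_measurable => //.
  rewrite add0r subr0 -mulrA.
  have h1 : 0 <= i%:R / n.+1%:R :> R by rewrite divr_ge0.
  have h2 : i%:R / n.+1%:R <= 1 :> R.
    by rewrite ler_pdivrMr ?ltr0n// mul1r ler_nat ltnW.
  rewrite mulr_ge0//=; apply: le_trans tT'.
  by rewrite -[leRHS]mulr1 ler_wpM2l.
move=> w _; apply/cvgrPdist_le => e e0.
have cqY : cont_on 0 t (fun u => q u * Y u w).
  by apply: cont_onS (cont_onM cq (cY w)).
have [n0 Hn] := segint_riemann t0 cqY e0.
by exists n0 => // n /= n0n; exact: Hn.
Qed.

Lemma B_measurable t : 0 <= t <= T -> measurable_fun setT (B t).
Proof. by case: HB => aB _ tT; exact: adapted_measurable. Qed.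

Lemma grid_time (n i : nat) : (i <= n)%N -> 0 <= T * (i%:R / n%:R) <= T.
Proof.
by move=> i_n; have := node_itv (ltW T0) i_n; rewrite /node subr0 add0r.
Qed.

(* For fixed n and m the Riemann sums at the times T a/n share one subdivision, so
   that the one at T a/n is a partial sum of the one at T b/n for a <= b. *)
Let rsum (n m a : nat) (w : Omega) : R :=
  \sum_(0 <= i < a * m) g (T * (i%:R / (n * m)%N%:R)) *
    (B (T * (i.+1%:R / (n * m)%N%:R)) w - B (T * (i%:R / (n * m)%N%:R)) w).

(** [riemann_dB] with index [k] has [k.+1] cells, so [k] is [a * m - 1]; at time 0 every sum
    vanishes and any index would do. The bound [m.-1 <= k] lets convergence in [k] be read as
    convergence in [m]. *)
Lemma riemann_dB_common (n m a : nat) : (0 < n)%N -> (0 < m)%N -> (a <= n)%N ->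
  exists2 k : nat, (m.-1 <= k)%N &
    forall w, riemann_dB g B (T * (a%:R / n%:R)) k w = rsum n m a w.
Proof.
move=> n0 m0 an; have [->|a0] := posnP a.
  exists m; first exact: leq_pred.
  move=> w; rewrite /rsum mul0n big_geq// /riemann_dB big1// => i _.
  by rewrite mul0r mulr0 !mul0r subrr mulr0.
have am0 : (0 < a * m)%N by rewrite muln_gt0 a0.
exists (a * m).-1.
  by rewrite -ltnS !prednK// leq_pmull.
move=> w; rewrite /riemann_dB /rsum prednK// -(big_mkord xpredT (fun i =>
  g (T * (a%:R / n%:R) * i%:R / (a * m)%N%:R) *
  (B (T * (a%:R / n%:R) * i.+1%:R / (a * m)%N%:R) w -
   B (T * (a%:R / n%:R) * i%:R / (a * m)%N%:R) w))).
apply: eq_bigr => i _.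
have E (j : nat) : T * (a%:R / n%:R) * j%:R / (a * m)%N%:R = T * (j%:R / (n * m)%N%:R).
  by rewrite !natrM; field; rewrite !pnatr_eq0 -!lt0n n0 m0 a0.
by rewrite !E.
Qed.

Lemma rsum_measurable n m a : (0 < n)%N -> (0 < m)%N -> (a <= n)%N ->
  measurable_fun setT (rsum n m a).
Proof.
move=> n0 m0 an; apply: (_ : measurable_fun setT (fun w => rsum n m a w)).
rewrite /rsum; under eq_fun do rewrite big_mkord.
apply: (@measurable_sum _ _ _ _ _ _ (fun (i : 'I_(a * m)) w => g (T * (i%:R / (n * m)%N%:R)) *
    (B (T * (i.+1%:R / (n * m)%N%:R)) w - B (T * (i%:R / (n * m)%N%:R)) w))) => i.
have i1 : (i < n * m)%N by apply: leq_trans (ltn_ord i) _; rewrite leq_mul2r an orbT.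
by apply: measurable_funM => //; apply: measurable_funB; apply: B_measurable;
  apply: grid_time => //; exact: ltnW.
Qed.

(** The failure sets below quantify over all times and all bounds [x], so negligibility is obtained
    from measurable covers of small probability instead of from the measure of the set itself. *)
Lemma negligible_small (A : set Omega) :
  (forall eps : R, 0 < eps -> exists V, [/\ measurable V, pr P V < eps & A `<=` V]) ->
  P.-negligible A.
Proof.
move=> H.
have H' (j : nat) : exists V, [/\ measurable V, pr P V < j.+1%:R^-1 & A `<=` V].
  by apply: H; rewrite invr_gt0.
pose V j := sval (cid (H' j)).
have VP j : [/\ measurable (V j), pr P (V j) < j.+1%:R^-1 & A `<=` V j].
  by rewrite /V; case: cid.
have mI : measurable (\bigcap_j V j) by apply: bigcapT_measurable => j; case: (VP j).
exists (\bigcap_j V j); split => //; last first.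
  by move=> w Aw j _; case: (VP j) => _ _; exact.
rewrite prE//; congr EFin; apply/eqP; rewrite eq_le pr_ge0 andbT.
apply: le_of_le_epsilon => j; rewrite add0r; have [mV /ltW le1 _] := VP j.
by apply: le_trans le1; apply: le_pr => // w; exact.
Qed.

Lemma rsum_dist_measurable n m a e : (0 < n)%N -> (0 < m)%N -> (a <= n)%N ->
  measurable [set w | e < `|sigma * rsum n m a w - N (T * (a%:R / n%:R)) w|].
Proof.
move=> n0 m0 an.
have -> : [set w | e < `|sigma * rsum n m a w - N (T * (a%:R / n%:R)) w|] =
   setT `&` (fun w => `|sigma * rsum n m a w - N (T * (a%:R / n%:R)) w|) @^-1` `]e, +oo[.
  by rewrite setTI; apply/seteqP; split => w /=; rewrite in_itv/= andbT.
apply: (_ : measurable_fun setT (fun w => `|sigma * rsum n m a w - N (T * (a%:R / n%:R)) w|)) => //.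
apply: measurableT_comp; first exact: normr_measurable.
apply: measurable_funB; last by apply: noise_measurable; exact: grid_time.
by apply: measurable_funM => //; exact: rsum_measurable.
Qed.

Lemma rsum_cvg n a : (0 < n)%N -> (a <= n)%N -> forall e eps : R, 0 < e -> 0 < eps ->
  exists m0 : nat, forall m, (m0 <= m)%N -> (0 < m)%N ->
    pr P [set w | e < `|sigma * rsum n m a w - N (T * (a%:R / n%:R)) w|] < eps.
Proof.
move=> n0 an e eps e0 eps0.
have tT := grid_time an.
have [k0 Hk] := cvgN tT e0 eps0; exists k0.+1 => m km m0.
have [k mk rE] := riemann_dB_common n0 m0 an.
have := Hk k (leq_trans _ mk); rewrite -ltnS prednK// => /(_ km).
under eq_fun do rewrite rE.
rewrite prE ?lte_fin//; exact: rsum_dist_measurable.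
Qed.

(** The Abel bound holds for every Riemann sum with the same right-hand side. A violation by more
    than [j.+1%:R^-1] therefore forces one of the two endpoint sums to miss its limit by more than
    half of that, an event of arbitrarily small probability as the mesh is refined. *)
Lemma noise_increment_grid (n a b : nat) : (0 < n)%N -> (a <= b)%N -> (b <= n)%N ->
  let s := T * (a%:R / n%:R) in let t := T * (b%:R / n%:R) in
  P.-negligible [set w | ~ forall x,
     (forall u, s <= u <= t -> `|B u w - B s w| <= x) ->
     `|N t w - N s w - sigma * (g t * (B t w - B s w))| <=
       sigma * (Lip * (t - s) * x)].
Proof.
move=> n0 ab bn s t; have an := leq_trans ab bn.
have nR : (0 : R) < n%:R by rewrite ltr0n.
have st : s <= t by rewrite ler_wpM2l ?(ltW T0)// ler_wpM2r ?invr_ge0// ler_nat.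
pose A j := [set w | exists2 x, forall u, s <= u <= t -> `|B u w - B s w| <= x &
  sigma * (Lip * (t - s) * x) + j.+1%:R^-1 <
     `|N t w - N s w - sigma * (g t * (B t w - B s w))|].
apply: (@negligibleS _ _ _ _ (\bigcup_j A j)).
  move=> w /= nw; apply: contrapT => nA; apply: nw => x Hx.
  apply: le_of_le_epsilon => j; rewrite leNgt; apply/negP => h.
  by apply: nA; exists j => //; exists x.
apply: negligible_bigcup => j; apply: negligible_small => eps eps0.
pose e : R := j.+1%:R^-1 / 2.
have e0 : 0 < e by rewrite divr_gt0// invr_gt0.
have eps2 : 0 < eps / 2 by lra.
have [ma Ha] := rsum_cvg n0 an e0 eps2.
have [mb Hb] := rsum_cvg n0 bn e0 eps2.
pose m := (maxn ma mb).+1.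
have m1 : (ma <= m)%N by rewrite leqW// leq_maxl.
have m2 : (mb <= m)%N by rewrite leqW// leq_maxr.
have m0 : (0 < m)%N by [].
exists ([set w | e < `|sigma * rsum n m a w - N s w|] `|`
        [set w | e < `|sigma * rsum n m b w - N t w|]).
have mV c : (c <= n)%N ->
    measurable [set w | e < `|sigma * rsum n m c w - N (T * (c%:R / n%:R)) w|].
  by move=> cn; apply: rsum_dist_measurable.
split; first by apply: measurableU; exact: mV.
  have := Ha m m1 m0; have := Hb m m2 m0.
  apply: (fun h1 h2 => le_lt_trans (pr_setU_le P (mV a an) (mV b bn)) _); lra.
move=> w [x Hx hA]; apply: contrapT => /not_orP[/negP + /negP].
rewrite -!leNgt => ha hb.
have mR : (0 : R) < m%:R by rewrite ltr0n.
have nmR : (0 : R) < (n * m)%N%:R by rewrite ltr0n muln_gt0 n0.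
have grid c : T * ((c * m)%N%:R / (n * m)%N%:R) = T * (c%:R / n%:R).
  by rewrite !natrM; field; rewrite !gt_eqF.
have abm : (a * m <= b * m)%N by rewrite leq_mul2r ab orbT.
have mono (i k : nat) : (i <= k)%N -> T * (i%:R / (n * m)%N%:R) <= T * (k%:R / (n * m)%N%:R).
  by move=> ik; rewrite ler_wpM2l ?(ltW T0)// ler_wpM2r ?invr_ge0 ?ler_nat// ltW.
have := @abel_bound (fun i => B (T * (i%:R / (n * m)%N%:R)) w)
  (fun i => g (T * (i%:R / (n * m)%N%:R))) (a * m) (b * m) (Lip * (T / (n * m)%N%:R)) x abm.
rewrite /= !grid -/s -/t.
have -> : Lip * (T / (n * m)%N%:R) * (b * m - a * m)%N%:R * x = Lip * (t - s) * x.
  rewrite natrB// /s /t !natrM; field; rewrite !gt_eqF//.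
have -> : \sum_(a * m <= i < b * m) g (T * (i%:R / (n * m)%N%:R)) *
    (B (T * (i.+1%:R / (n * m)%N%:R)) w - B (T * (i%:R / (n * m)%N%:R)) w) =
    rsum n m b w - rsum n m a w.
  by rewrite /rsum (big_cat_nat (n := a * m) (leq0n _) abm)/= addrAC subrr add0r.
move=> Habel.
have {Habel} : `|rsum n m b w - rsum n m a w - g t * (B t w - B s w)| <= Lip * (t - s) * x.
  apply: Habel.
  - by rewrite mulr_ge0 ?(ltW Lip0)// divr_ge0 ?(ltW T0)// ltW.
  - move=> i /andP[ai ib]; have inm : (i < n * m)%N.
      by apply: leq_trans ib _; rewrite leq_mul2r bn orbT.
    apply: le_trans (gLip _ _) _.
    + exact: grid_time.
    + by apply: grid_time; exact: ltnW.
    + rewrite ler_wpM2l ?(ltW Lip0)// -mulrBr -mulrBl -natrB// subSnn mul1r.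
      by rewrite ger0_norm// divr_ge0 ?(ltW T0)// ltW.
  - move=> i /andP[ai ib]; apply: Hx; apply/andP; split.
      by rewrite /s -(grid a); exact: mono.
    by rewrite /t -(grid b); exact: mono.
set D := rsum _ _ _ _ - _ - _ => HD.
have : `|sigma * D| <= sigma * (Lip * (t - s) * x).
  by rewrite normrM gtr0_norm// ler_pM2l.
have DE : N t w - N s w - sigma * (g t * (B t w - B s w)) = sigma * D
   - (sigma * rsum n m b w - N t w) + (sigma * rsum n m a w - N s w) by rewrite /D; ring.
rewrite DE in hA; rewrite -/s -/t in ha hb.
have e2 : j.+1%:R^-1 = e + e by rewrite /e -splitr.
rewrite e2 in hA; move: hA.
have := ler_normD (sigma * D - (sigma * rsum n m b w - N t w)) (sigma * rsum n m a w - N s w).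
have := ler_normB (sigma * D) (sigma * rsum n m b w - N t w).
by move: ha hb; clear; lra.
Qed.

Lemma noise0_negligible : P.-negligible [set w | N 0 w != 0].
Proof.
pose A j := [set w | j.+1%:R^-1 < `|N 0 w|].
apply: (@negligibleS _ _ _ _ (\bigcup_j A j)).
  move=> w /= nw; apply: contrapT => nA; move/negP: nw; apply.
  rewrite -normr_le0; apply: le_of_le_epsilon => j; rewrite add0r leNgt.
  by apply/negP => h; apply: nA; exists j.
apply: negligible_bigcup => j; apply: negligible_small => eps eps0.
have e0 : 0 < j.+1%:R^-1 :> R by rewrite invr_gt0.
have [m0 Hm] := rsum_cvg (isT : (0 < 1)%N) (isT : (0 <= 1)%N) e0 eps0.
have := Hm m0.+1 (leqnSn _) (ltn0Sn _).
have := rsum_dist_measurable j.+1%:R^-1 (isT : (0 < 1)%N) (ltn0Sn m0) (isT : (0 <= 1)%N).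
rewrite mul0r mulr0 /rsum mul0n.
under eq_fun do rewrite big_geq// mulr0 sub0r normrN.
by move=> mA lt; exists (A j); split.
Qed.

(** Countably many pairs of rational grid times give one null set; path continuity then frees the
    right endpoint. The left endpoint may stay on a grid, since it will always be a mesh point. *)
Lemma noise_path_bounds : exists Z, [/\ measurable Z, pr P Z = 0 &
  forall w, ~ Z w -> [/\ cont_on 0 T (fun t => B t w), B 0 w = 0, N 0 w = 0 &
    forall (n a : nat) t x, (0 < n)%N -> (a <= n)%N ->
      let s := T * (a%:R / n%:R) in s <= t <= T ->
      (forall u, s <= u <= t -> `|B u w - B s w| <= x) ->
      `|N t w - N s w - sigma * (g t * (B t w - B s w))| <=
        sigma * (Lip * (t - s) * x)]].
Proof.
pose bad n a b := [set w | ~ (((0 < n)%N /\ (a <= b)%N /\ (b <= n)%N) ->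
  let s := T * (a%:R / n%:R) in let t := T * (b%:R / n%:R) in
  forall x, (forall u, s <= u <= t -> `|B u w - B s w| <= x) ->
     `|N t w - N s w - sigma * (g t * (B t w - B s w))| <=
       sigma * (Lip * (t - s) * x))].
have Hbad : P.-negligible (\bigcup_n \bigcup_a \bigcup_b bad n a b).
  apply: negligible_bigcup => n; apply: negligible_bigcup => a.
  apply: negligible_bigcup => b.
  have [[n0 [ab bn]]|nh] := pselect ((0 < n)%N /\ (a <= b)%N /\ (b <= n)%N).
    apply: negligibleS (noise_increment_grid n0 ab bn) => w /= nw h.
    by apply: nw => _ x Hx; exact: h.
  apply: negligibleS (negligible_set0 P) => w /= nw.
  by exfalso; apply: nw => h; exfalso; exact: nh.
have [_ [aeB _]] := HB.
have [Z [mZ PZ ZH]] := negligibleU (negligibleU Hbad noise0_negligible) aeB.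
exists Z; split => //; first by rewrite /pr PZ.
move=> w nZ.
have [B0 cB] : B 0 w = 0 /\ {within `[0, T], continuous (fun t => B t w)}.
  by apply: contrapT => h; apply/nZ/ZH; right.
have N0 : N 0 w = 0.
  by apply: contrapT => /eqP h; apply/nZ/ZH; left; right.
have {}cB : cont_on 0 T (fun t => B t w) by apply/within_contP.
have good n a b : (0 < n)%N -> (a <= b)%N -> (b <= n)%N -> ~ bad n a b w.
  by move=> _ _ _ h; apply/nZ/ZH; left; left; exists n => //; exists a => //; exists b.
split => // n a t x n0 an s /andP[st tT] Hx.
have /andP[s0 sT] := grid_time an; rewrite -/s in s0 sT.
rewrite leNgt; apply/negP => h.
have cN : cont_on 0 T (fun t => N t w).
  apply: cont_onD => //.
  have cqY := cont_onM cq (cY w).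
  have [M M0 HM] := cont_on_bounded cqY.
  apply: (@lipschitz_cont_on _ _ _ _ M).
  have Hle u v : 0 <= u -> u <= v -> v <= T ->
     `|segint 0 u (fun u => q u * Y u w) - segint 0 v (fun u => q u * Y u w)| <= M * `|u - v|.
    move=> u0 uv vT; rewrite (@segint_split _ 0 v u) ?u0//; last by apply: cont_onS cqY.
    have cuv : cont_on u v (fun u => q u * Y u w) by apply: cont_onS cqY.
    rewrite opprD addrA subrr add0r normrN distrC (ger0_norm (_ : 0 <= v - u)) ?subr_ge0//.
    have : forall z, u <= z <= v -> - M <= q z * Y z w <= M.
      by move=> z /andP[uz zv]; rewrite -ler_norml; apply: HM; apply/andP; split; lra.
    move=> /(segint_bounds uv cuv) /andP[h1 h2].
    by rewrite ler_norml; apply/andP; split; lra.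
  move=> u v /andP[u0 uT] /andP[v0 vT]; have [uv|/ltW vu] := leP u v; first exact: Hle.
  by rewrite distrC (distrC u); exact: Hle.
have cg : cont_on 0 T g := lipschitz_cont_on gLip.
pose phi r := N r w - N s w - sigma * (g r * (B r w - B s w)).
have cphi : cont_on 0 T phi.
  apply: cont_onD; first by apply: cont_onD => //; exact: cont_on_cst.
  apply: cont_onN; apply: cont_onM; first exact: cont_on_cst.
  by apply: cont_onM => //; apply: cont_onD => //; exact: cont_on_cst.
have t0T : 0 <= t <= T by apply/andP; split; lra.
have gap : 0 < `|phi t| - sigma * (Lip * (t - s) * x) by rewrite subr_gt0.
have [d0 d00 Hd] := cphi t t0T _ gap.
have x0 : 0 <= x.
  have := Hx s; rewrite lexx st subrr normr0; exact.
(* Refining the grid from [n] to [n * m] cells keeps [s] a node while placing a node within [d0]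
   below [t]. From below, so that the bound [x] on [s, t] still applies on [s, t']. *)
pose m := (Num.truncn (T / d0)).+1.
have m0 : (0 < m)%N by [].
have nmR : (0 : R) < (n * m)%N%:R by rewrite ltr0n muln_gt0 n0.
have mR : (0 : R) < m%:R by rewrite ltr0n.
have nR : (0 : R) < n%:R by rewrite ltr0n.
have md : T / (n * m)%N%:R < d0.
  rewrite ltr_pdivrMr// mulrC -ltr_pdivrMr//.
  apply: lt_le_trans (truncnS_gt _) _; rewrite ler_nat -/m leq_pmull//.
pose z := t / T * (n * m)%N%:R.
have z0 : 0 <= z by rewrite mulr_ge0// divr_ge0 ?(le_trans s0 st) ?(ltW T0).
pose b := Num.truncn z.
have /andP[b1 b2] : b%:R <= z < b.+1%:R by exact: truncn_itv z0.
have zE : T * (z / (n * m)%N%:R) = t.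
  by rewrite /z; field; rewrite !gt_eqF.
have bn : (b <= n * m)%N.
  rewrite -(ler_nat R); apply: le_trans b1 _; rewrite /z ler_piMl ?(ltW nmR)//.
  by rewrite ler_pdivrMr// mul1r.
have sE : T * ((a * m)%N%:R / (n * m)%N%:R) = s.
  by rewrite /s !natrM; field; rewrite !gt_eqF.
have ab : (a * m <= b)%N.
  rewrite -ltnS -(ltr_nat R); apply: le_lt_trans b2.
  rewrite /z -(@ler_pM2r _ T)// -(@ler_pM2r _ (n * m)%N%:R^-1) ?invr_gt0//.
  have -> : t / T * (n * m)%N%:R * T / (n * m)%N%:R = t by field; rewrite !gt_eqF.
  by have -> : (a * m)%N%:R * T / (n * m)%N%:R = s by rewrite -sE mulrA (mulrC T).
pose t' := T * (b%:R / (n * m)%N%:R).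
have t't : t' <= t.
  by rewrite /t' -zE ler_wpM2l ?(ltW T0)// ler_wpM2r ?invr_ge0 ?(ltW nmR).
have tt' : t < t' + d0.
  rewrite -zE; apply: (@lt_trans _ _ (t' + T / (n * m)%N%:R)); last by rewrite ltrD2l.
  rewrite /t' -mulrDr ltr_pM2l// -[X in _ + X]mul1r -mulrDl.
  by rewrite ltr_pM2r ?invr_gt0// natr1.
have st' : s <= t'.
  by rewrite -sE /t' ler_wpM2l ?(ltW T0)// ler_wpM2r ?invr_ge0 ?(ltW nmR)// ler_nat.
have t'T : 0 <= t' <= T by rewrite (le_trans s0 st') (le_trans t't tT).
apply: (good (n * m)%N (a * m)%N b) => //; first by rewrite muln_gt0 n0.
move=> /(_ (conj _ (conj ab bn))); rewrite muln_gt0 n0 => /(_ isT) /=.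
rewrite sE -/t' => /(_ x) H.
have {}H : `|phi t'| <= sigma * (Lip * (t' - s) * x).
  by apply: H => u /andP[su ut']; apply: Hx; rewrite su (le_trans ut').
have := Hd t' t'T; rewrite (_ : `|t - t'| < d0); last by rewrite ger0_norm ?subr_ge0//; lra.
move=> /(_ isT) close.
have : sigma * (Lip * (t' - s) * x) <= sigma * (Lip * (t - s) * x).
  by rewrite ler_wpM2l ?(ltW sigma0)// ler_wpM2r// ler_wpM2l ?(ltW Lip0)//; lra.
have := lerB_dist (phi t) (phi t'); lra.
Qed.

End WienerIntegralPaths.


(** * Probabilities of failing to escape and of returning *)

Section EscapeAndReturn.
Context {d : measure_display} {Omega : measurableType d} {R : realType}.
Context {T : R} {P : probability Omega R} {Fil : R -> set (set Omega)}.
Context {B : R -> Omega -> R}.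
Hypothesis T0 : 0 < T.
Hypothesis HF : filtration Fil.
Hypothesis HB : brownian T P Fil B.

Definition jump (t : nat -> R) (x : R) (i : nat) : set Omega :=
  [set w | x < B (t i.+1) w - B (t i) w].

Lemma jump_fil (t : nat -> R) (x : R) (i j : nat) :
  {homo t : i j / (i <= j)%N >-> i <= j} -> 0 <= t 0%N -> t j <= T -> (i < j)%N ->
  Fil (t j) (jump t x i).
Proof.
move=> th t0 tT ij.
have h1 : 0 <= t i by apply: le_trans t0 _; exact: th.
have h2 : t i <= t i.+1 by apply: th.
have h3 : t i.+1 <= t j by apply: th.
apply: meas_wrt_gt; apply: meas_wrtB; first exact: fil_salg.
- by apply: (brownian_meas HF HB) => //; apply/andP; split; lra.
- by apply: (brownian_meas HF HB); [apply/andP; split; lra | lra].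
Qed.

(** The event of no success so far belongs to the past, so each further attempt multiplies its
    probability by at most [1 - p]. *)
Lemma pr_no_jump (t : nat -> R) (x h : R) (n : nat) :
  0 < h -> 0 <= x -> 0 <= t 0%N -> (forall i, t i.+1 = t i + h) -> t n <= T ->
  pr P (~` \big[setU/set0]_(i < n) jump t x i) <=
    (1 - (Num.sqrt (pi *+ 2))^-1 * expR (- ((x / Num.sqrt h + 1) ^+ 2 / 2))) ^+ n.
Proof.
move=> h0 x0 t0 tS; set p := _ * expR _.
have th : {homo t : i j / (i <= j)%N >-> i <= j}.
  by apply: homo_leq => // [? ? ?|i]; [exact: le_trans | rewrite tS lerDl ltW].
have FU m j : (m <= j)%N -> t j <= T -> Fil (t j) (\big[setU/set0]_(i < m) jump t x i).
  move=> mj tT; apply: salg_bigsetU; first exact: fil_salg.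
  by move=> i im; apply: jump_fil => //; exact: leq_trans im mj.
elim: n => [|n IH] tT; first by rewrite big_ord0 setC0 prT expr0.
have tnT : t n <= T by apply: le_trans tT; exact: th.
rewrite big_ord_recr/=; set U := \big[setU/set0]_(i < n) _.
have FUn : Fil (t n) (~` U) by apply: salgC; [exact: fil_salg | exact: FU].
have mU := fil_measurable HF FUn.
have mJ : measurable (jump t x n) by apply: (fil_measurable HF (t := t n.+1)); exact: jump_fil.
have t0n : 0 <= t n by apply: le_trans t0 _; exact: th.
have tlt : t n < t n.+1 by rewrite tS ltrDl.
have := pr_incr_gt_lb HF HB t0n tlt tT FUn x0.
have -> : t n.+1 - t n = h by rewrite tS addrAC subrr add0r.
rewrite -/p -/(jump t x n) => low.
rewrite setCU -setDE.
have := pr_setI_D P mU mJ; have := IH tnT; have := pr_le1 P (measurableI _ _ mU mJ).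
have := pr_ge0 P (~` U); rewrite -/U exprS.
(* The lower bound applied to the sure event shows that [p] is at most a probability; this makes
   [1 - p] a legitimate factor for the induction hypothesis. *)
have p1 : p <= 1.
  have := pr_incr_gt_lb HF HB t0n tlt tT (A := setT) _ x0.
  rewrite prT mul1r setTI tS (addrC (t n)) addrK -/p; move=> /(_ _)/le_trans; apply.
    by have := fil_salg HF (t n) => -[F0 FC _]; rewrite -setC0 -setTD; exact: FC.
  by apply: pr_le1; rewrite addrC -tS.
move=> q0 q1 q2 q3.
apply: (@le_trans _ _ ((1 - p) * pr P (~` U))); first by lra.
by rewrite ler_wpM2l// subr_ge0.
Qed.

Definition first_in (S : nat -> set Omega) (i : nat) : set Omega :=
  S i `\` \big[setU/set0]_(j < i) S j.

Lemma first_in_exists (S : nat -> set Omega) n w : S n w ->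
  exists2 i, (i <= n)%N & first_in S i w.
Proof.
elim/ltn_ind: n => n IH Sn.
have [[i i_n Si]|nS] := pselect (exists2 i, (i < n)%N & S i w).
  have [j ji Fj] := IH i i_n Si; exists j => //.
  exact: leq_trans ji (ltnW i_n).
exists n => //; split => //; rewrite -bigcup_mkord => -[i /= i_n Si].
by apply: nS; exists i.
Qed.

Lemma sum_pr_first_in (S : nat -> set Omega) n : (forall i, measurable (S i)) ->
  \sum_(i < n) pr P (first_in S i) <= 1.
Proof.
move=> mS; have mU m : measurable (\big[setU/set0]_(i < m) S i).
  by apply: bigsetU_measurable.
suff -> : \sum_(i < n) pr P (first_in S i) = pr P (\big[setU/set0]_(i < n) S i).
  exact: pr_le1.
elim: n => [|n IH]; first by rewrite !big_ord0 pr0.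
rewrite !big_ord_recr/= IH -pr_setU//.
- by congr pr; rewrite /first_in setDE setUIr setUCr setIT.
- exact: measurableD.
- by rewrite setIC; apply/seteqP; split => // w [[]].
Qed.

(* The j-th block has length 2^j l and exit level c 2^j l / sigma; the Ottaviani
   bound for it is of order sigma^2 / (2^j l), which is summable in j. *)
Definition block_exit (t l c sigma : R) (J : nat) : set Omega :=
  \big[setU/set0]_(j < J)
    exceed (B := B) t (Num.min T (t + 2 ^+ j * l)) (c * (2 ^+ j * l) / sigma).

Lemma block_exit_measurable t l c sigma J : 0 <= t <= T -> 0 < l ->
  measurable (block_exit t l c sigma J).
Proof.
move=> /andP[t0 tT] l0; rewrite /block_exit.
apply: (big_ind measurable) => // [A C mA mC|j _]; first exact: measurableU.
have h : 0 <= 2 ^+ j * l by rewrite mulr_ge0 ?exprn_ge0// ltW.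
have h1 : t <= Num.min T (t + 2 ^+ j * l) by rewrite le_min tT lerDl.
have h2 : Num.min T (t + 2 ^+ j * l) <= T by rewrite ge_min lexx.
by apply: (fil_measurable HF (t := Num.min T (t + 2 ^+ j * l))); apply: (exceed_fil HF HB).
Qed.

Lemma sum_half_le2 (J : nat) : \sum_(j < J) (2 ^+ j : R)^-1 <= 2.
Proof.
suff : \sum_(j < J) (2 ^+ j : R)^-1 = 2 - 2 / 2 ^+ J.
  move=> ->; rewrite lerBlDr lerDl divr_ge0// exprn_ge0//.
elim: J => [|J IH]; first by rewrite big_ord0 expr0 divr1 subrr.
rewrite big_ord_recr/= IH exprS; field; exact: expf_neq0.
Qed.

(** Block j contributes [32 * sigma ^+ 2 / (c ^+ 2 * l)] times [2 ^- j]; the geometric sum is at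
    most 2, uniformly in [J]. Truncation at [T] only shortens a block. *)
Lemma pr_block_exit (t l c sigma : R) (J : nat) A : 0 <= t <= T -> 0 < l -> 0 < c ->
  0 < sigma -> Fil t A ->
  pr P (A `&` block_exit t l c sigma J) <= pr P A * (64 * sigma ^+ 2 / (c ^+ 2 * l)).
Proof.
move=> /andP[t0 tT] l0 c0 s0 FA; have mA := fil_measurable HF FA.
rewrite /block_exit big_distrr/=.
set F := fun j : nat => exceed (B := B) t (Num.min T (t + 2 ^+ j * l)) (c * (2 ^+ j * l) / sigma).
have pos (j : nat) : 0 < (2 ^+ j * l : R) by rewrite mulr_gt0 ?exprn_gt0.
have h1 (j : nat) : t <= Num.min T (t + 2 ^+ j * l) by rewrite le_min tT lerDl ltW.
have h2 (j : nat) : Num.min T (t + 2 ^+ j * l) <= T by rewrite ge_min lexx.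
have mF j : measurable (A `&` F j).
  apply: measurableI => //; apply: (fil_measurable HF (t := Num.min T (t + 2 ^+ j * l))).
  exact: (exceed_fil HF HB).
apply: (@le_trans _ _ (\sum_(j < J) pr P (A `&` F j))).
  exact: (@pr_bigsetU_le _ _ _ P _ _ (fun j : 'I_J => A `&` F j)).
apply: (@le_trans _ _ (\sum_(j < J) pr P A * (32 * sigma ^+ 2 / (c ^+ 2 * l)) * (2 ^+ j)^-1)).
  apply: ler_sum => j _.
  apply: le_trans (pr_exceed HF HB _ _ _ FA _) _ => //.
    by rewrite divr_gt0// mulr_gt0.
  rewrite -[leRHS]mulrA ler_wpM2l ?pr_ge0//.
  have lam : Num.min T (t + 2 ^+ j * l) - t <= 2 ^+ j * l.
    by rewrite lerBlDl ge_min lexx orbT.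
  apply: (@le_trans _ _ (32 * (2 ^+ j * l) / (c * (2 ^+ j * l) / sigma) ^+ 2)).
    rewrite ler_wpM2r ?invr_ge0 ?exprn_ge0 ?ler_pM2l//.
    by rewrite divr_ge0 ?mulr_ge0// ltW.
  rewrite le_eqVlt; apply/orP; left; apply/eqP; field.
  by rewrite !gt_eqF// exprn_gt0.
rewrite -mulr_sumr -[leLHS]mulrA ler_wpM2l ?pr_ge0//.
apply: (@le_trans _ _ (32 * sigma ^+ 2 / (c ^+ 2 * l) * 2)).
  rewrite ler_wpM2l ?sum_half_le2//.
  by rewrite divr_ge0 ?mulr_ge0 ?exprn_ge0// ltW.
by rewrite le_eqVlt; apply/orP; left; apply/eqP; field; rewrite !gt_eqF.
Qed.

(** This does the work of a strong Markov property. For each deterministic index the first-entry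
    event lies in the past, so the same block bound applies; the first-entry events are disjoint and
    their probabilities sum to at most 1. *)
Lemma pr_return (S : nat -> set Omega) (t : nat -> R) (l c sigma : R) (n J : nat) :
  0 < l -> 0 < c -> 0 < sigma ->
  (forall i, (i < n)%N -> 0 <= t i <= T) ->
  (forall i, measurable (S i)) ->
  (forall i, (i < n)%N -> Fil (t i) (first_in S i)) ->
  pr P (\big[setU/set0]_(i < n) (first_in S i `&` block_exit (t i) l c sigma J)) <=
    64 * sigma ^+ 2 / (c ^+ 2 * l).
Proof.
move=> l0 c0 s0 tT mS FS.
have Kge : 0 <= 64 * sigma ^+ 2 / (c ^+ 2 * l).
  by rewrite divr_ge0 ?mulr_ge0 ?exprn_ge0// ltW.
have mG (i : 'I_n) : measurable (first_in S i `&` block_exit (t i) l c sigma J).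
  apply: measurableI; last by apply: block_exit_measurable => //; exact: tT.
  by apply: (fil_measurable HF (t := t i)); exact: FS.
apply: le_trans (pr_bigsetU_le P _ mG) _.
apply: (@le_trans _ _ (\sum_(i < n) pr P (first_in S i) * (64 * sigma ^+ 2 / (c ^+ 2 * l)))).
  by apply: ler_sum => i _; apply: pr_block_exit => //; [exact: tT | exact: FS].
by rewrite -mulr_suml ler_piMl// sum_pr_first_in.
Qed.

End EscapeAndReturn.

(** * A path that has escaped upwards follows k *)

Section PathDichotomy.
Context {R : realType}.
Context {T : R}.

(** After [s], the trap gives the lower bound and the speed limit given by [k] the upper one; before
    [s] both [mu] and [k] are small because [k s] is. The factor 2 on [rho] comes from increments of
    [N], whose values are bounded by [rho]. *)
Lemma trapped_close (s a l eps rho : R) (mu N k Y : R -> R) :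
  0 <= s -> s <= a -> a <= T -> 0 < l -> 0 <= eps <= 1 ->
  cont_on 0 T mu -> cont_on 0 T k -> k 0 = 0 -> mu 0 = 0 -> N 0 = 0 ->
  (forall u t, 0 <= u -> u <= t -> t <= T -> k u <= k t) ->
  (forall u t, 0 <= u -> u <= t -> t <= T ->
     (forall v, u <= v <= t -> Y v <= - (1 - eps)) ->
     (1 - eps) * (k t - k u) + (N t - N u) <= mu t - mu u) ->
  (forall u t, 0 <= u -> u <= t -> t <= T ->
     `|mu t - mu u - (N t - N u)| <= k t - k u) ->
  (forall t, 0 <= t <= T -> l + Num.max (k t - k a) 0 <= mu t ->
     Y t <= - (1 - eps)) ->
  2 * l <= mu s ->
  (forall t, s <= t <= T ->
     - (l / 2) - (1 - eps) / 2 * (k t - k s) <= N t - N s) ->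
  (forall t, 0 <= t <= T -> `|N t| <= rho) ->
  eps * k T + 2 * rho < k a - k s ->
  forall t, 0 <= t <= T -> `|mu t - k t| <= 2 * k s + eps * k T + 2 * rho.
Proof.
move=> s0 sa aT l0 e01 cmu ck k0 mu0 N0 knd H1 H1' H2 mus N1 N2 kas t /andP[t0 tT].
have /andP[e0 e1] := e01.
have ks0 : 0 <= k s by rewrite -k0; apply: knd => //; lra.
have kt0 : 0 <= k t by rewrite -k0; apply: knd.
have kT0 : 0 <= k T by rewrite -k0; apply: knd => //; lra.
have N2' u : 0 <= u <= T -> - rho <= N u <= rho by rewrite -ler_norml; exact: N2.
have ekT : 0 <= eps * k T by rewrite mulr_ge0.
have := H1' 0 t (lexx 0) t0 tT; rewrite k0 mu0 N0 !subr0 ler_norml => /andP[u1 u2].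
have /andP[n1 n2] := N2' t ltac:(by rewrite t0).
have [ts|/ltW st] := leP t s.
  have kts : k t <= k s by apply: knd => //; lra.
  by rewrite ler_norml; apply/andP; split; lra.
have main : (1 - eps) * (k t - k s) - 2 * rho <= mu t - mu s.
  apply: (@barrier_trap _ T s a l eps (2 * rho) mu N k Y) => //.
  - move=> u /andP[su uT].
    have /andP[a1 a2] := N2' u ltac:(apply/andP; split; lra).
    have /andP[b1 b2] := N2' s ltac:(apply/andP; split; lra).
    lra.
  - have : eps * (k T - k s) <= eps * k T by rewrite ler_wpM2l//; lra.
    lra.
  - by rewrite st.
have ktT : k t <= k T by apply: knd => //; lra.
have : eps * (k t - k s) <= eps * k T by rewrite ler_wpM2l//; lra.
rewrite ler_norml => h; apply/andP; split; nra.
Qed.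

End PathDichotomy.


(** * The dichotomy at a fixed noise level *)

Section DichotomyFixedNoise.
Context {R : realType}.

Lemma dense_grid (T t e : R) : 0 < T -> 0 <= t <= T -> 0 < e ->
  exists n i : nat, [/\ (0 < n)%N, (i <= n)%N & `|t - T * (i%:R / n%:R)| < e].
Proof.
move=> T0 /andP[t0 tT] e0.
pose n := (Num.truncn (T / e)).+1.
have n0 : (0 : R) < n%:R by rewrite ltr0n.
have Tn : T / n%:R < e.
  by rewrite ltr_pdivrMr// mulrC -ltr_pdivrMr//; exact: truncnS_gt.
pose z := t / T * n%:R.
have z0 : 0 <= z by rewrite mulr_ge0// ?divr_ge0//; lra.
have /andP[b1 b2] := truncn_itv z0; set i := Num.truncn z in b1 b2 *.
have zE : T * (z / n%:R) = t by rewrite /z; field; rewrite !gt_eqF.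
exists n, i; split => //.
  rewrite -(ler_nat R); apply: le_trans b1 _; rewrite /z ler_piMl ?(ltW n0)//.
  by rewrite ler_pdivrMr// mul1r.
rewrite -zE -mulrBr -mulrBl ger0_norm; last first.
  by rewrite mulr_ge0 ?(ltW T0)// divr_ge0 ?subr_ge0// ltW.
apply: le_lt_trans Tn; rewrite ler_wpM2l ?(ltW T0)// -[leRHS]mul1r.
by rewrite ler_wpM2r ?invr_ge0 ?(ltW n0)// lerBlDl natr1 ltW.
Qed.

Lemma geometric_block (l r : R) (J : nat) : 0 < l -> r <= 2 ^+ J * l ->
  r <= l \/ exists2 j, (j < J)%N & 2 ^+ j * l < r <= 2 ^+ j.+1 * l.
Proof.
move=> l0; elim: J => [|J IH] h; first by left; rewrite expr0 mul1r in h.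
have [/IH[|[j jJ rj]]|rJ] := leP r (2 ^+ J * l); first by left.
  by right; exists j => //; rewrite ltnS ltnW.
by right; exists J => //; rewrite rJ.
Qed.

Lemma near_minus1 (p q e : R) : `|p + 1| <= e -> `|q| <= e -> p - q <= - (1 - 2 * e).
Proof. by rewrite !ler_norml; lra. Qed.

Context {d : measure_display} {Omega : measurableType d}.
Context {T kappa : R} {eta : R -> R} {P : probability Omega R}.
Context {Fil : R -> set (set Omega)} {B mu Y Dl : R -> Omega -> R}.
Context {thetat : R -> R -> R} {sigma : R}.
Hypothesis T0 : 0 < T.
Hypothesis ceta : cont_on 0 T eta.
Hypothesis sigma0 : 0 < sigma.

Local Notation w_ := (wfun T kappa eta).
Local Notation k := (kfun T kappa eta).

Hypothesis HF : filtration Fil.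
Hypothesis HB : brownian T P Fil B.
Hypothesis amu : adapted T Fil mu.
Hypothesis aY : adapted T Fil Y.
Hypothesis aDl : adapted T Fil Dl.
Hypothesis cmu : forall w, cont_on 0 T (fun t => mu t w).
Hypothesis cY : forall w, cont_on 0 T (fun t => Y t w).
Hypothesis cDl : forall w, cont_on 0 T (fun t => Dl t w).
Hypothesis Y1 : forall t w, 0 <= t <= T -> -1 <= Y t w <= 1.
Hypothesis cvgN : forall t, 0 <= t <= T ->
  cvg_in_prob P (fun n w => sigma * riemann_dB (fun u => (w_ u)^-1) B t n w)
    (fun w => mu t w + segint 0 t (fun u => w_ u ^- 2 * Y u w)).
Hypothesis YE : forall t w, 0 <= t <= T -> Y t w = thetat t (mu t w) - Dl t w.

(** By continuity a strict excess at one time persists at a nearby rational grid time, so a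
    countable union suffices. *)
Lemma sup_gt_measurable (e : R) :
  measurable [set w | exists t, (0 <= t <= T) /\ (e < `|Dl t w|)].
Proof.
have -> : [set w | exists t, (0 <= t <= T) /\ (e < `|Dl t w|)] =
    \bigcup_n \bigcup_i [set w | (0 < n)%N /\ (i <= n)%N /\ e < `|Dl (T * (i%:R / n%:R)) w|].
  apply/seteqP; split => w /=.
    move=> [t [tT et]].
    have [|r r0 Hr] := cDl w tT (e := `|Dl t w| - e); first by rewrite subr_gt0.
    have [n [i [n0 i_n ti]]] := dense_grid T0 tT r0.
    exists n => //; exists i => //; split => //; split => //.
    have := Hr _ (grid_time T0 i_n) ti.
    have := lerB_dist (Dl t w) (Dl (T * (i%:R / n%:R)) w); lra.
  move=> [n _ [i _ [n0 [i_n h]]]]; exists (T * (i%:R / n%:R)); split => //.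
  exact: grid_time.
apply: bigcupT_measurable => n; apply: bigcupT_measurable => i.
have [[n0 i_n]|nh] := pselect ((0 < n)%N /\ (i <= n)%N); last first.
  rewrite [X in measurable X](_ : _ = set0)//.
  by apply/seteqP; split => // w [? [? _]]; apply: nh.
rewrite [X in measurable X](_ : _ = [set w | e < `|Dl (T * (i%:R / n%:R)) w|]); last first.
  by apply/seteqP; split => [w [_ []]|w].
have gT := grid_time T0 i_n.
apply: (fil_measurable HF (t := T * (i%:R / n%:R))).
by apply: meas_wrt_norm_gt; [exact: (fil_salg HF) | exact: aDl].
Qed.

Context {gm gM Lip m M : R}.
Hypothesis gm0 : 0 < gm.
Hypothesis gM0 : 0 < gM.
Hypothesis Lip0 : 0 < Lip.
Hypothesis m0 : 0 < m.
Hypothesis gb : forall t, 0 <= t <= T -> gm <= (w_ t)^-1 <= gM.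
Hypothesis gLip : forall s t, 0 <= s <= T -> 0 <= t <= T ->
  `|(w_ s)^-1 - (w_ t)^-1| <= Lip * `|s - t|.
Hypothesis kb : forall s t, 0 <= s -> s <= t -> t <= T ->
    m * (t - s) <= k t - k s <= M * (t - s).

Context {a l eps rho K c x : R} {n n0 J : nat}.
Hypothesis n_gt0 : (0 < n)%N.
Hypothesis n0n : (n0 < n)%N.
Hypothesis l0 : 0 < l.
Hypothesis eps0 : 0 < eps.
Hypothesis eps1 : eps <= 1 / 4.
Hypothesis K0 : 0 < K.
Hypothesis x0 : 0 <= x.
Hypothesis c0 : 0 < c.
Hypothesis aT : a <= T.
Hypothesis thetatE : forall t y, 0 <= t <= T ->
  l + Num.max (k t - k a) 0 <= `|y| -> `|thetat t y + Num.sg y| <= eps.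
Hypothesis noise_small : sigma * (gM + Lip * T) * K <= rho.
(** The term [4 * l] is the width of the layer |mu| < 2 l. The other two pay for the Abel error,
    with [2 * K] bounding the oscillation of [B], and for an adverse drift over one cell. *)
Hypothesis jump_large :
  4 * l + sigma * Lip * (T / n%:R) * (2 * K) + M * (T / n%:R) <= sigma * gm * x.
(** [gM + Lip * T] converts oscillation of [B] into oscillation of the noise. This inequality serves
    the first block, where the noise is weighed against [l / 2], and the next one the later blocks,
    where it is weighed against the drift. *)
Hypothesis c_half : (gM + Lip * T) * c <= 1 / 2.
Hypothesis c_m : (gM + Lip * T) * c <= m / 8.
Hypothesis J_large : T <= 2 ^+ J * l.
Hypothesis time_small : T * (n0%:R / n%:R) <= a.
Hypothesis margin : 2 * eps * k T + 2 * rho < k a - k (T * (n0%:R / n%:R)).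

Let t_ (i : nat) : R := T * (i%:R / n%:R).
Let N (t : R) (w : Omega) : R := mu t w + segint 0 t (fun u => w_ u ^- 2 * Y u w).

Let t_itv i : (i <= n)%N -> 0 <= t_ i <= T.
Proof. exact: grid_time. Qed.

Let t_S i : t_ i.+1 = t_ i + T / n%:R.
Proof. by rewrite /t_ -natr1 mulrDl mulrDr mul1r. Qed.

Let h0 : 0 < T / n%:R.
Proof. by rewrite divr_gt0// ltr0n. Qed.

Let t_homo : {homo t_ : i j / (i <= j)%N >-> i <= j}.
Proof.
apply: homo_leq => // [? ? ?|i]; [exact: le_trans | by rewrite t_S lerDl ltW].
Qed.

Let S_ (i : nat) : set Omega := [set w | (i <= n0)%N /\ 2 * l <= `|mu (t_ i) w|].

Let S_fil i j : (i <= j)%N -> (j <= n)%N -> Fil (t_ j) (S_ i).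
Proof.
move=> ij jn; have salg := fil_salg HF (t_ j).
have iT := t_itv (leq_trans ij jn).
have [i_n|i_n] := leqP i n0; last first.
  rewrite (_ : S_ i = set0); first by case: salg.
  by apply/seteqP; split => // w []; rewrite leqNgt i_n.
rewrite (_ : S_ i = ~` [set w | `|mu (t_ i) w| < 2 * l]); last first.
  by apply/seteqP; split => w /=; [move=> [_ h]; apply/negP; rewrite -leNgt|
    move=> /negP; rewrite -leNgt].
apply: salgC => //.
rewrite (_ : [set w | _ ] = (fun w => `|mu (t_ i) w|) @^-1` `]-oo, (2 * l)[); last first.
  by apply/seteqP; split => w /=; rewrite in_itv.
have : meas_wrt (Fil (t_ j)) (fun w => `|mu (t_ i) w|); last exact.
by apply: meas_wrt_norm => //; apply: (meas_wrt_filS HF (t_homo ij)); exact: amu.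
Qed.

Let drift_norm w u t : 0 <= u -> u <= t -> t <= T ->
  `|mu t w - mu u w - (N t w - N u w)| <= k t - k u.
Proof.
move=> u0 ut tT.
have := segint_drift_norm (kappa := kappa) T0 ceta u0 ut tT (cY w) (fun v vT => Y1 w vT).
by congr (`|_| <= _); rewrite /N; ring.
Qed.

Let k_nd u t : 0 <= u -> u <= t -> t <= T -> k u <= k t.
Proof. exact: kfun_nd. Qed.

Let path_close w :
  cont_on 0 T (fun t => B t w) -> B 0 w = 0 -> N 0 w = 0 ->
  (forall (n a : nat) t x, (0 < n)%N -> (a <= n)%N ->
      let s := T * (a%:R / n%:R) in s <= t <= T ->
      (forall u, s <= u <= t -> `|B u w - B s w| <= x) ->
      `|N t w - N s w - sigma * ((w_ t)^-1 * (B t w - B s w))| <=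
        sigma * (Lip * (t - s) * x)) ->
  (forall u, 0 <= u <= T -> `|B u w| <= K) ->
  (forall t, 0 <= t <= T -> `|Dl t w| <= eps) ->
  (exists2 i, (i < n0)%N & x < B (t_ i.+1) w - B (t_ i) w) ->
  (forall i, (i <= n0)%N -> first_in S_ i w ->
     ~ block_exit (T := T) (B := B) (t_ i) l c sigma J.+1 w) ->
  (forall t, 0 <= t <= T -> `|mu t w - k t| <= 2 * k (t_ n0) + 2 * eps * k T + 2 * rho) \/
  (forall t, 0 <= t <= T -> `|mu t w + k t| <= 2 * k (t_ n0) + 2 * eps * k T + 2 * rho).
Proof.
move=> cB B0 N0 HN BK DlE [i0 i0n jmp] Hexit.
have l0' := l0; have eps0' := eps0; have eps1' := eps1; have T0' := T0.
have C1 : 0 < gM + Lip * T by rewrite addr_gt0// mulr_gt0.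
have mu0 : mu 0 w = 0 by move: N0; rewrite /N segint_xx addr0.
have osc i t y : (i <= n)%N -> t_ i <= t <= T ->
    (forall u, t_ i <= u <= t -> `|B u w - B (t_ i) w| <= y) ->
    `|N t w - N (t_ i) w| <= sigma * ((gM + Lip * T) * y).
  move=> i_n /andP[it tT] Hy; have := HN n i t y n_gt0 i_n _ Hy.
  rewrite -/(t_ i) it tT => /(_ isT).
  have /andP[ti0 tiT] := t_itv i_n.
  have Byt : `|B t w - B (t_ i) w| <= y by apply: Hy; rewrite it lexx.
  have y0 : 0 <= y by apply: le_trans Byt.
  have /andP[g1 g2] := gb (t := t) ltac:(apply/andP; split; lra).
  have h1 : `|sigma * ((w_ t)^-1 * (B t w - B (t_ i) w))| <= sigma * (gM * y).
    rewrite normrM gtr0_norm// ler_pM2l// normrM.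
    by apply: ler_pM => //; rewrite ger0_norm// invr_ge0 ltW// wfun_gt0.
  have h2 : sigma * (Lip * (t - t_ i) * y) <= sigma * (Lip * T * y).
    by rewrite ler_pM2l// ler_wpM2r// ler_pM2l//; lra.
  move=> h3; have := ler_normD
    (N t w - N (t_ i) w - sigma * ((w_ t)^-1 * (B t w - B (t_ i) w)))
    (sigma * ((w_ t)^-1 * (B t w - B (t_ i) w))).
  rewrite subrK; lra.
have t_0 : t_ 0%N = 0 by rewrite /t_ mul0r mulr0.
have Nrho t : 0 <= t <= T -> `|N t w| <= rho.
  move=> tT; have := @osc 0%N t K (leq0n _).
  rewrite t_0 tT N0 subr0 => /(_ isT) h; apply: le_trans (h _) _; last by rewrite mulrA.
  by move=> u /andP[u0 ut]; rewrite B0 subr0; apply: BK; rewrite u0 (le_trans ut)//; case/andP: tT.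
(* If the cell starts inside the layer, hence above [- 2 * l], the net upward move of at least
   [4 * l] ends it at or above [2 * l]. *)
have escape : 2 * l <= `|mu (t_ i0) w| \/ 2 * l <= `|mu (t_ i0.+1) w|.
  have i1n : (i0.+1 <= n)%N by apply: leq_trans i0n (ltnW n0n).
  have /andP[a1 a2] := t_itv (ltnW i1n); have /andP[b1 b2] := t_itv i1n.
  have tt : t_ i0 <= t_ i0.+1 by apply: t_homo.
  have := HN n i0 (t_ i0.+1) (2 * K) n_gt0 (ltnW i1n).
  rewrite /= -/(t_ i0) tt b2 => /(_ isT) h.
  have : `|N (t_ i0.+1) w - N (t_ i0) w -
      sigma * ((w_ (t_ i0.+1))^-1 * (B (t_ i0.+1) w - B (t_ i0) w))| <=
      sigma * (Lip * (T / n%:R) * (2 * K)).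
    rewrite (_ : T / n%:R = t_ i0.+1 - t_ i0); last by rewrite t_S addrAC subrr add0r.
    apply: h => u /andP[u1 u2]; apply: le_trans (ler_normB _ _) _.
    have q1 := BK u ltac:(apply/andP; split; lra).
    have q2 := BK (t_ i0) ltac:(apply/andP; split; lra).
    lra.
  have := drift_norm w a1 tt b2.
  have /andP[_ kM] := kb a1 tt b2.
  have tS : t_ i0.+1 - t_ i0 = T / n%:R by rewrite t_S addrAC subrr add0r.
  rewrite tS in kM.
  have /andP[g1 _] := gb (t_itv i1n).
  have big : sigma * gm * x <= sigma * ((w_ (t_ i0.+1))^-1 * (B (t_ i0.+1) w - B (t_ i0) w)).
    rewrite -mulrA ler_pM2l//; apply: ler_pM => //; exact: ltW.
  rewrite !ler_norml => /andP[d1 d2] /andP[e1 e2].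
  have [|hlt] := leP (2 * l) `|mu (t_ i0) w|; first by left.
  right; move: hlt; rewrite ltr_norml => /andP[f1 f2].
  have hh := jump_large; have := ler_norm (mu (t_ i0.+1) w).
  by lra.
have [i i_n0 Fi] : exists2 i, (i <= n0)%N & first_in S_ i w.
  have [h|h] := escape.
    have [|i h1 h2] := @first_in_exists _ _ S_ i0 w; first by split => //; exact: ltnW.
    by exists i => //; exact: leq_trans h1 (ltnW i0n).
  have [|i h1 h2] := @first_in_exists _ _ S_ i0.+1 w; first by split.
  by exists i => //; exact: leq_trans h1 i0n.
have i_n : (i <= n)%N by exact: leq_trans i_n0 (ltnW n0n).
have Bexit := Hexit i i_n0 Fi.
have mui : 2 * l <= `|mu (t_ i) w| by case: Fi => -[].
have /andP[s0 sT] := t_itv i_n; set s := t_ i in s0 sT mui Bexit.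
(* Index [J] itself is included, which is why [block_exit] is taken with [J.+1] blocks: a time in
   the dyadic range [j < J] is covered by block [j.+1]. *)
have block t j : s <= t <= T -> (j <= J)%N -> t - s <= 2 ^+ j * l ->
    `|N t w - N s w| <= (gM + Lip * T) * c * (2 ^+ j * l).
  move=> /andP[st tT] jJ tj.
  have jl0 : 0 <= 2 ^+ j * l by rewrite mulr_ge0 ?exprn_ge0// ltW.
  have nexc : ~ exceed (B := B) s (Num.min T (s + 2 ^+ j * l)) (c * (2 ^+ j * l) / sigma) w.
    move=> h; apply: Bexit; rewrite /block_exit -(bigcup_mkord _ (fun j =>
      exceed (B := B) s (Num.min T (s + 2 ^+ j * l)) (c * (2 ^+ j * l) / sigma))).
    by exists j.
  have sm : s <= Num.min T (s + 2 ^+ j * l) by rewrite le_min sT lerDl.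
  have tm : t <= Num.min T (s + 2 ^+ j * l) by rewrite le_min tT; lra.
  have cBs : cont_on s (Num.min T (s + 2 ^+ j * l)) (fun u => B u w).
    by apply: cont_onS cB => //; rewrite ge_min lexx.
  have Hu := not_exceed_le sm cBs nexc.
  apply: le_trans (@osc i t (c * (2 ^+ j * l) / sigma) i_n _ _) _; rewrite -/s.
  - by rewrite st.
  - by move=> u /andP[su ut]; apply: Hu; rewrite su (le_trans ut).
  - by rewrite le_eqVlt; apply/orP; left; apply/eqP; field; rewrite gt_eqF.
(* Up to time [l] the noise is at most [l / 2]. If 2^j l < t - s <= 2^(j+1) l, it is at most [m / 8]
   times twice 2^j l, hence at most [m * (t - s) / 4], which [eps <= 1 / 4] places below half of the
   drift. *)
have back t : s <= t <= T -> `|N t w - N s w| <= l / 2 + (1 - 2 * eps) / 2 * (k t - k s).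
  move=> stT; have /andP[st tT] := stT.
  have /andP[km _] := kb s0 st tT.
  have kge : m * (t - s) / 4 <= (1 - 2 * eps) / 2 * (k t - k s).
    have mts : 0 <= m * (t - s) by rewrite mulr_ge0 ?(ltW m0)// subr_ge0.
    have : 1 / 4 * (k t - k s) <= (1 - 2 * eps) / 2 * (k t - k s).
      by rewrite ler_wpM2r//; have := eps1; lra.
    by lra.
  have tsJ : t - s <= 2 ^+ J * l by apply: le_trans J_large; lra.
  have [tl|[j jJ /andP[j1 j2]]] := geometric_block l0 tsJ.
    have := @block t 0%N stT (leq0n _); rewrite expr0 mul1r => /(_ tl).
    have : (gM + Lip * T) * c * l <= 1 / 2 * l by rewrite ler_wpM2r// ltW.
    have : 0 <= m * (t - s) by rewrite mulr_ge0 ?(ltW m0)// subr_ge0.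
    lra.
  have := @block t j.+1 stT jJ j2.
  rewrite (_ : 2 ^+ j.+1 * l = 2 * (2 ^+ j * l)); last by rewrite exprS mulrA.
  move=> h.
  have jl0 : 0 <= 2 ^+ j * l by rewrite mulr_ge0 ?exprn_ge0// ltW.
  have : (gM + Lip * T) * c * (2 * (2 ^+ j * l)) <= m / 8 * (2 * (2 ^+ j * l)).
    by rewrite ler_wpM2r// mulr_ge0.
  have : m * (2 ^+ j * l) <= m * (t - s) by rewrite ler_pM2l// ltW.
  by set p := 2 ^+ j * l in jl0 j1 h *; have := l0; lra.
have sn0 : s <= t_ n0 by apply: t_homo.
have t0T := t_itv (ltnW n0n).
have ks : k s <= k (t_ n0) by apply: k_nd => //; case/andP: t0T.
have sa : s <= a by apply: le_trans sn0 _.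
have eps01 : 0 <= 2 * eps <= 1 by apply/andP; split; lra.
have marg : 2 * eps * k T + 2 * rho < k a - k s 
  by apply: lt_le_trans margin _; rewrite lerD2l lerN2.
have k0 := @kfun0 R T kappa eta.
have ck := cont_on_kfun (kappa := kappa) T0 ceta.
have concl (z : R) : z <= 2 * k s + 2 * eps * k T + 2 * rho ->
    z <= 2 * k (t_ n0) + 2 * eps * k T + 2 * rho.
  by move=> h; apply: le_trans h _; rewrite !lerD2r ler_pM2l.
have bar0 t : 0 <= Num.max (k t - k a) 0 by rewrite le_max lexx orbT.
(* An escape downwards is the upward case for [- mu], [- N] and [- Y]. The loss is [2 * eps] because
   the error of [thetat] and [Dl] each contribute [eps]. *)
case: (leP 0 (mu s w)) mui => [mus0|mus0] mui; [left|right] => t tT; apply: concl.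
- apply: (@trapped_close _ T s a l (2 * eps) rho (mu^~ w) (N^~ w) k (Y^~ w)) => //.
  + move=> u v u0 uv vT Yle.
    have h := segint_drift_ge (kappa := kappa) T0 ceta u0 uv vT (cY w) Yle.
    rewrite -lerBrDr /N; apply: le_trans h _.
    by rewrite le_eqVlt; apply/orP; left; apply/eqP; ring.
  + by move=> u v u0 uv vT; exact: drift_norm.
  + move=> v vT hv; rewrite YE//.
    have mv0 : 0 < mu v w by apply: lt_le_trans hv; rewrite ltr_wpDr.
    have := thetatE vT (y := mu v w); rewrite gtr0_norm// => /(_ hv).
    by rewrite gtr0_sg// => h; apply: near_minus1 h (DlE v vT).
  + by move: mui; rewrite ger0_norm.
  + by move=> v vT; have := back v vT; rewrite ler_norml opprD => /andP[].
- rewrite -normrN opprD.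
  apply: (@trapped_close _ T s a l (2 * eps) rho (fun v => - mu v w) (fun v => - N v w) k
    (fun v => - Y v w)) => //.
  + exact: cont_onN.
  + by rewrite mu0 oppr0.
  + by rewrite N0 oppr0.
  + move=> u v u0 uv vT Yle.
    have := segint_drift_ge (kappa := kappa) T0 ceta u0 uv vT (cont_onN (cY w)) Yle.
    have EN b : 0 <= b <= T -> segint 0 b (fun z => w_ z ^- 2 * - Y z w) =
        - segint 0 b (fun z => w_ z ^- 2 * Y z w).
      move=> /andP[b0 bT]; rewrite -mulN1r -segintZ; last first.
        by apply: cont_onS (cont_onM (cont_on_q T0 ceta) (cY w)).
      by apply: eq_Rintegral => z _; ring.
    rewrite (EN u); last by rewrite u0 (le_trans uv).
    rewrite (EN v); last by rewrite vT (le_trans u0).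
    rewrite -lerBrDr /N => h; apply: le_trans h _.
    by rewrite le_eqVlt; apply/orP; left; apply/eqP; ring.
  + move=> u v u0 uv vT; have := drift_norm w u0 uv vT.
    by rewrite -normrN; congr (`|_| <= _); ring.
  + move=> v vT hv; rewrite YE//.
    have mv0 : mu v w < 0 by rewrite -oppr_gt0; apply: lt_le_trans hv; rewrite ltr_wpDr.
    have := thetatE vT (y := mu v w); rewrite ltr0_norm// => /(_ hv).
    rewrite ltr0_sg// => h.
    rewrite (_ : - (_ - _) = - thetat v (mu v w) - - Dl v w); last by rewrite opprB opprK addrC.
    by apply: near_minus1; rewrite ?normrN ?DlE// -normrN opprD opprK.
  + by move: mui; rewrite ltr0_norm.
  + move=> v vT; have := back v vT; rewrite ler_norml => /andP[_ h].
    by rewrite -!opprD lerN2.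
  + by move=> v vT; rewrite normrN; exact: Nrho.
Qed.

(** The four terms correspond to [B] leaving [-K, K], [Dl] exceeding [eps], no large increment among
    the first [n0] cells, and the noise beating half of the drift after the first mesh point outside
    the layer. *)
Lemma dichotomy : exists Bad : set Omega, [/\ measurable Bad,
  pr P Bad <= 32 * T / K ^+ 2
    + pr P [set w | exists t, (0 <= t <= T) /\ (eps < `|Dl t w|)]
    + (1 - (Num.sqrt (pi *+ 2))^-1 *
           expR (- ((x / Num.sqrt (T / n%:R) + 1) ^+ 2 / 2))) ^+ n0
    + 64 * sigma ^+ 2 / (c ^+ 2 * l) &
  forall w, ~ Bad w ->
    (forall t, 0 <= t <= T ->
       `|mu t w - k t| <= 2 * k (T * (n0%:R / n%:R)) + 2 * eps * k T + 2 * rho) \/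
    (forall t, 0 <= t <= T ->
       `|mu t w + k t| <= 2 * k (T * (n0%:R / n%:R)) + 2 * eps * k T + 2 * rho)].
Proof.
have [Z [mZ PZ HZ]] := noise_path_bounds T0 sigma0 Lip0 gLip (cont_on_q T0 ceta) HF HB
  amu aY cmu cY cvgN.
pose E1 := exceed (B := B) 0 T K.
pose E2 := [set w | exists t, (0 <= t <= T) /\ (eps < `|Dl t w|)].
pose E3 := ~` \big[setU/set0]_(i < n0) jump (B := B) t_ x i.
(* There are [n0] cells but [n0.+1] possible first mesh points, since the last jump may end at node
   [n0]. *)
pose E4 := \big[setU/set0]_(i < n0.+1)
   (first_in S_ i `&` block_exit (T := T) (B := B) (t_ i) l c sigma J.+1).
have tT i : (i < n0.+1)%N -> 0 <= t_ i <= T by move=> h; apply: t_itv; exact/ltnW/(leq_trans h n0n).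
have FS i : (i < n0.+1)%N -> Fil (t_ i) (first_in S_ i).
  move=> i_n0; have i_n : (i <= n)%N by exact/ltnW/(leq_trans i_n0 n0n).
  apply: salgD; [exact: fil_salg HF _ | exact: S_fil |].
  by apply: salg_bigsetU; [exact: fil_salg HF _ | move=> j ji; apply: S_fil => //; exact: ltnW].
have mS i : measurable (S_ i).
  have [i_n|i_n] := leqP i n; first by apply: (fil_measurable HF (t := t_ i)); exact: S_fil.
  rewrite (_ : S_ i = set0)//; apply/seteqP; split => // w [h _].
  by have := leq_ltn_trans h (ltn_trans n0n i_n); rewrite ltnn.
have m1 : measurable E1 by apply: (fil_measurable HF (t := T)); apply: (exceed_fil HF HB) => //; exact: ltW.
have m2 : measurable E2 by exact: sup_gt_measurable.
have m3 : measurable E3.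
  apply: measurableC; apply: bigsetU_measurable => i _.
  apply: (fil_measurable HF (t := t_ i.+1)); apply: (jump_fil HF HB) => //.
    by case/andP: (t_itv (leq0n n)).
  by case/andP: (tT i.+1 ltac:(by rewrite ltnS)).
have m4 : measurable E4.
  apply: bigsetU_measurable => i _; apply: measurableI.
    by apply: (fil_measurable HF (t := t_ i)); exact: FS.
  by apply: (block_exit_measurable HF HB) => //; exact: tT.
have m12 := measurableU _ _ m1 m2; have m123 := measurableU _ _ m12 m3.
have m1234 := measurableU _ _ m123 m4.
exists (E1 `|` E2 `|` E3 `|` E4 `|` Z); split; first exact: measurableU.
- have := pr_setU_le P m1234 mZ; have := pr_setU_le P m123 m4.
  have := pr_setU_le P m12 m3; have := pr_setU_le P m1 m2.
  have p1 : pr P E1 <= 32 * T / K ^+ 2.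
    have := pr_exceed HF HB (lexx 0) (ltW T0) (lexx T) (A := setT) _ K0.
    rewrite setTI prT mul1r subr0; apply.
    have [F0 FC _] := fil_salg HF 0; rewrite -setC0 -setTD; exact: FC.
  have p3 := pr_no_jump HF HB h0 x0 (t := t_) (n := n0).
  have {}p3 := p3 ltac:(by case/andP: (t_itv (leq0n n))) t_S
    ltac:(by case/andP: (t_itv (ltnW n0n))).
  have p4 := pr_return HF HB J.+1 l0 c0 sigma0 tT mS FS.
  rewrite -/E3 in p3; rewrite -/E4 in p4; rewrite PZ -/E2; lra.
- move=> w nBad.
  have nE1 : ~ E1 w by move=> h; apply: nBad; left; left; left; left.
  have nE2 : ~ E2 w by move=> h; apply: nBad; left; left; left; right.
  have nE3 : ~ E3 w by move=> h; apply: nBad; left; left; right.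
  have nE4 : ~ E4 w by move=> h; apply: nBad; left; right.
  have nZ : ~ Z w by move=> h; apply: nBad; right.
  have [cB B0 N0 HN] := HZ w nZ.
  apply: path_close => //.
  + move=> u uT; have := not_exceed_le (ltW T0) cB nE1 uT.
    by rewrite B0 subr0.
  + move=> t tT'; rewrite leNgt; apply/negP => h; apply: nE2; by exists t.
  + move: nE3 => /contrapT; rewrite -bigcup_mkord => -[i /= i_n h].
    by exists i.
  + move=> i i_n0 Fi Bi; apply: nE4; rewrite /E4 -(bigcup_mkord _
      (fun i => first_in S_ i `&` block_exit (T := T) (B := B) (t_ i) l c sigma J.+1)).
    by exists i => //=; rewrite ltnS.
Qed.

End DichotomyFixedNoise.


(** * Choice of the mesh and of the jump size as sigma tends to 0 *)

Section SmallNoise.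
Context {R : realType}.

Definition eventually0 (Q : R -> Prop) :=
  exists2 e : R, 0 < e & forall s, 0 < s -> s < e -> s < 1 -> Q s.

Lemma eventually0I Q1 Q2 : eventually0 Q1 -> eventually0 Q2 ->
  eventually0 (fun s => Q1 s /\ Q2 s).
Proof.
move=> [e1 e10 H1] [e2 e20 H2]; exists (Num.min e1 e2); first by rewrite lt_min e10.
by move=> s s0; rewrite lt_min => /andP[s1 s2] sl; split; [exact: H1 | exact: H2].
Qed.

Lemma eventually0_lt c : 0 < c -> eventually0 (fun s => s < c).
Proof. by move=> c0; exists c. Qed.

Lemma eventually0_sub (Q1 Q2 : R -> Prop) : eventually0 Q1 ->
  (forall s, 0 < s -> s < 1 -> Q1 s -> Q2 s) -> eventually0 Q2.
Proof.
by move=> [e e0 H] Q12; exists e => // s s0 se s1; apply: Q12 => //; exact: H.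
Qed.

(** Multiply by [(1 + p) ^+ n], which Bernoulli's inequality bounds below by [n%:R * p]; the product
    is [(1 - p ^+ 2) ^+ n], at most 1. *)
Lemma expr1B_le (p : R) n : 0 < p -> p <= 1 -> (0 < n)%N ->
  (1 - p) ^+ n <= (n%:R * p)^-1.
Proof.
move=> p0 p1 n0.
have np : 0 < n%:R * p by rewrite mulr_gt0// ltr0n.
have bern m : 1 + m%:R * p <= (1 + p) ^+ m.
  elim: m => [|m IH]; first by rewrite mul0r addr0 expr0.
  rewrite exprS -natr1; have : (1 + p) * (1 + m%:R * p) <= (1 + p) * (1 + p) ^+ m.
    by rewrite ler_pM2l//; lra.
  have : 0 <= m%:R * p * p by rewrite !mulr_ge0// ltW.
  lra.
rewrite -[leRHS]mul1r ler_pdivlMr//.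
apply: (@le_trans _ _ ((1 - p) ^+ n * (1 + p) ^+ n)).
  rewrite ler_wpM2l//; first by rewrite exprn_ge0// subr_ge0.
  by have := bern n; lra.
by rewrite -exprMn exprn_ile1//; nra.
Qed.

Lemma sqrt2pi_gt1 : 1 < Num.sqrt (pi *+ 2 : R).
Proof.
rewrite -sqrtr1 ltr_sqrt; have := pi_ge2 R; rewrite mulr2n; lra.
Qed.

(* With a mesh T/n of order sigma^2 the increments of B needed to cross the layer
   |mu| < 2 sigma^2 L are of order L standard deviations, hence each has probability
   at least of order exp (- D^2 L^2 / 2) >= sigma, against n of order sigma^-2 trials. *)
Lemma escape_parameters (T tau gm Lip Mk K eta L sigma : R) (D : R) :
  0 < tau -> tau < T -> 0 < gm -> 0 <= Lip -> 0 <= Mk -> 0 <= K ->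
  D = (4 + 2 * K * Lip * T + Mk * T) / gm / Num.sqrt (T / 2) + 1 ->
  0 < sigma -> sigma < 1 -> 1 <= L ->
  (D * L) ^+ 2 / 2 <= - ln sigma ->
  2 * T * sigma ^+ 2 <= tau ->
  2 * T * sigma * Num.sqrt (pi *+ 2) <= eta * tau ->
  exists n n0 : nat, exists x : R, [/\ (0 < n)%N, (n0 < n)%N, 0 <= x,
    T * (n0%:R / n%:R) <= tau &
    4 * (sigma ^+ 2 * L) + sigma * Lip * (T / n%:R) * (2 * K) + Mk * (T / n%:R)
      <= sigma * gm * x /\
    (1 - (Num.sqrt (pi *+ 2))^-1 *
       expR (- ((x / Num.sqrt (T / n%:R) + 1) ^+ 2 / 2))) ^+ n0 <= eta].
Proof.
move=> tau0 tauT gm0 Lip0 Mk0 K0 DE s0 s1 L1 DL small1 small2.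
have T0 : 0 < T by lra.
have s2 : 0 < sigma ^+ 2 by rewrite exprn_gt0.
have s2V : 1 < sigma ^- 2 by rewrite invf_gt1// exprn_ilt1// ?ltW.
(* This puts the number of cells between sigma^-2 and 2 sigma^-2, so that the mesh lies between T
   sigma^2 / 2 and T sigma^2. *)
pose n := (Num.truncn (sigma ^- 2)).+1.
have nlb : sigma ^- 2 <= n%:R by apply/ltW; exact: truncnS_gt.
have nub : n%:R <= 2 * sigma ^- 2.
  have /andP[h _] := truncn_itv (ltW (lt_trans ltr01 s2V)).
  by rewrite /n -natr1; lra.
have n0 : (0 : R) < n%:R by rewrite ltr0n.
have h1 : T / n%:R <= T * sigma ^+ 2.
  by rewrite ler_pM2l// -[leRHS]invrK lef_pV2 ?posrE ?invr_gt0.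
have h2 : T * sigma ^+ 2 / 2 <= T / n%:R.
  rewrite -mulrA ler_pM2l// -[leLHS]invrK lef_pV2 ?posrE ?invr_gt0//; last lra.
  by rewrite invf_div mulrC mulrC.
have h0 : 0 < T / n%:R by rewrite divr_gt0.
set h := T / n%:R in h0 h1 h2 *.
(* The real number of cells fitting before time [tau]. It is at least 2, so its integer part, the
   number of attempts, is at least [z / 2]. *)
pose z := n%:R * (tau / T).
have z2 : 2 <= z.
  have : 2 <= sigma ^- 2 * (tau / T).
    by rewrite mulrC ler_pdivlMr// ler_pdivlMr//; lra.
  by move=> /le_trans; apply; rewrite ler_wpM2r// divr_ge0// ltW.
have z0 : 0 <= z by lra.
have /andP[z3 z4] := truncn_itv z0; set m := Num.truncn z in z3 z4.
have mz : z / 2 <= m%:R by rewrite -natr1 in z4; lra.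
have m0 : (0 : R) < m%:R by lra.
pose num := 4 * (sigma ^+ 2 * L) + sigma * Lip * h * (2 * K) + Mk * h.
have sg : 0 < sigma * gm by rewrite mulr_gt0.
have num0 : 0 <= num.
  by rewrite /num !addr_ge0 ?mulr_ge0// ?ltW//; lra.
pose x := num / (sigma * gm).
have x0 : 0 <= x by rewrite divr_ge0// ltW.
exists n, m, x; split => //.
- rewrite -(ltr_nat R); apply: le_lt_trans z3 _; rewrite /z gtr_pMr//.
  by rewrite ltr_pdivrMr// mul1r.
- have -> : tau = T * (z / n%:R) by rewrite /z; field; rewrite !gt_eqF.
  by rewrite ler_pM2l// ler_pM2r// invr_gt0.
split.
  have -> : sigma * gm * x = num by rewrite /x mulrC divfK// gt_eqF.
  exact: lexx.
pose C := 4 + 2 * K * Lip * T + Mk * T.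
have KLT : 0 <= 2 * K * Lip * T by rewrite !mulr_ge0// ltW.
have MT : 0 <= Mk * T by rewrite mulr_ge0// ltW.
have C0 : 0 < C by rewrite /C; lra.
(* [sigma < 1] removes the extra factor from the Abel term, and [1 <= L] lets the terms without [L]
   be multiplied by it. *)
have numle : num <= sigma ^+ 2 * (C * L).
  have e1 : sigma * Lip * h * (2 * K) <= sigma ^+ 2 * (2 * K * Lip * T).
    apply: (@le_trans _ _ (Lip * h * (2 * K))).
      rewrite -!mulrA ler_piMl ?(ltW s1)//.
      by rewrite !mulr_ge0// ?ltW.
    have -> : sigma ^+ 2 * (2 * K * Lip * T) = Lip * (T * sigma ^+ 2) * (2 * K) by ring.
    by rewrite ler_wpM2r ?mulr_ge0// ler_wpM2l.
  have e2 : Mk * h <= sigma ^+ 2 * (Mk * T).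
    have -> : sigma ^+ 2 * (Mk * T) = Mk * (T * sigma ^+ 2) by ring.
    by rewrite ler_wpM2l.
  apply: (@le_trans _ _ (sigma ^+ 2 * (4 * L + 2 * K * Lip * T + Mk * T))).
    by rewrite /num !mulrDr; lra.
  rewrite ler_pM2l// /C.
  by set u := 2 * K * Lip * T in KLT *; set v := Mk * T in MT *; nra.
have xle : x <= sigma * (C / gm * L).
  rewrite /x ler_pdivrMr//; apply: le_trans numle _.
  by rewrite le_eqVlt; apply/orP; left; apply/eqP; field; rewrite gt_eqF.
have sT2 : 0 < Num.sqrt (T / 2) by rewrite sqrtr_gt0; lra.
have sqh : sigma * Num.sqrt (T / 2) <= Num.sqrt h.
  rewrite -{1}(ger0_norm (ltW s0)) -sqrtr_sqr -sqrtrM ?sqr_ge0// ler_sqrt ?(ltW h0)//.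
  by rewrite mulrA (mulrC _ T).
(* Counted in standard deviations the jump is at most [(D - 1) * L]; the [+ 1] in [D] absorbs the
   extra 1 of the Gaussian lower bound, as [1 <= L]. *)
have ratio : x / Num.sqrt h + 1 <= D * L.
  apply: (@le_trans _ _ (C / gm / Num.sqrt (T / 2) * L + 1)); last by rewrite DE -/C; lra.
  rewrite lerD2r ler_pdivrMr; last by rewrite sqrtr_gt0.
  apply: le_trans xle _.
  have -> : sigma * (C / gm * L) = C / gm / Num.sqrt (T / 2) * L * (sigma * Num.sqrt (T / 2)).
    by field; rewrite !gt_eqF.
  apply: ler_wpM2l; last exact: sqh.
  by rewrite !mulr_ge0 ?invr_ge0 ?(ltW C0) ?(ltW gm0) ?(ltW sT2)//; lra.
have c1 := sqrt2pi_gt1; set c := Num.sqrt (pi *+ 2) in c1 small2 *.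
have cp : 0 < c := lt_trans ltr01 c1.
set E := expR _.
have EE : sigma <= E.
  rewrite -{1}(lnK s0) ler_expR lerNr; apply: le_trans DL.
  rewrite ler_wpM2r ?invr_ge0// ler_sqr ?nnegrE//.
    by rewrite addr_ge0// divr_ge0// sqrtr_ge0.
  by apply: le_trans ratio; rewrite addr_ge0// divr_ge0// sqrtr_ge0.
have E0 : 0 < E by exact: expR_gt0.
have E1 : E <= 1 by rewrite /E -expR0 ler_expR oppr_le0 divr_ge0// sqr_ge0.
have p0 : 0 < c^-1 * E by rewrite mulr_gt0// invr_gt0.
have p1 : c^-1 * E <= 1.
  by rewrite mulrC ler_pdivrMr// mul1r (le_trans E1)// ltW.
apply: le_trans (expr1B_le p0 p1 _) _; first by rewrite -(ltr_nat R).
have cV : 0 < c^-1 by rewrite invr_gt0.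
rewrite -[leLHS]mul1r ler_pdivrMr ?mulr_gt0//.
have eta0 : 0 < eta.
  have : 0 < eta * tau.
    by apply: lt_le_trans small2; rewrite !mulr_gt0.
  by rewrite pmulr_lgt0.
(* Number of attempts times success probability is at least tau / (2 T sigma c), which blows up as
   sigma tends to 0; [small2] says that it has reached 1 / eta. *)
apply: (@le_trans _ _ (eta * (sigma ^- 2 * (tau / T) / 2 * (c^-1 * sigma)))).
  have -> : eta * (sigma ^- 2 * (tau / T) / 2 * (c^-1 * sigma)) =
      eta * tau / (2 * T * sigma * c) by field; rewrite !gt_eqF.
  by rewrite ler_pdivlMr ?mul1r// !mulr_gt0.
rewrite ler_pM2l//; apply: ler_pM => //.
- by rewrite divr_ge0// mulr_ge0 ?invr_ge0 ?divr_ge0 ?sqr_ge0// ltW.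
- by rewrite mulr_ge0// ltW.
- by apply: le_trans mz; rewrite ler_pM2r// /z ler_wpM2r// divr_ge0 ?(ltW tau0) ?(ltW T0).
- by rewrite ler_pM2l.
Qed.

End SmallNoise.

(** * Expectations of a functional close to one of two values *)

Section Sandwich.
Context {d : measure_display} {Omega : measurableType d} {R : realType}.
Variable P : probability Omega R.
Local Open Scope ereal_scope.

(* No measurability is assumed: the integral is a difference of suprema over
   simple minorants, which is monotone for arbitrary functions. *)
Lemma le_integral_arbitrary (f g : Omega -> \bar R) : (forall w, f w <= g w) ->
  \int[P]_w f w <= \int[P]_w g w.
Proof.
move=> fg; rewrite /integral !patch_setT; apply: leeB.
  apply: le_ereal_sup => _ [h Hh <-]; exists h => // w.
  by apply: le_trans (Hh w) _; rewrite !funeposE le_max2//.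
apply: le_ereal_sup => _ [h Hh <-]; exists h => // w.
by apply: le_trans (Hh w) _; rewrite !funenegE le_max2// leeN2.
Qed.

Local Open Scope ring_scope.

Lemma integral_three_indic (A1 A2 A3 : set Omega) (c1 c2 c3 : R) :
  measurable A1 -> measurable A2 -> measurable A3 ->
  (\int[P]_w (c1 * \1_A1 w + c2 * \1_A2 w + c3 * \1_A3 w)%:E)%E =
    (c1 * pr P A1 + c2 * pr P A2 + c3 * pr P A3)%:E.
Proof.
move=> m1 m2 m3.
have ii (A : set Omega) (c : R) : measurable A ->
    P.-integrable setT (EFin \o (fun w => c * \1_A w)).
  move=> mA; rewrite (_ : EFin \o _ = (fun w => c%:E * (\1_A w)%:E)%E); last first.
    by apply/funext => w; rewrite /= EFinM.
  by apply: integrableZl => //; exact: integrable_indic.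
have i1 (A : set Omega) (c : R) : measurable A ->
    (\int[P]_w (c * \1_A w)%:E = (c * pr P A)%:E)%E.
  move=> mA; under eq_integral do rewrite EFinM.
  rewrite integralZl//; last exact: integrable_indic.
  by rewrite integral_indic// setIT EFinM -prE.
have i12 : P.-integrable setT (EFin \o (fun w => c1 * \1_A1 w + c2 * \1_A2 w)).
  rewrite (_ : EFin \o _ = (fun w => (c1 * \1_A1 w)%:E + (c2 * \1_A2 w)%:E)%E); last first.
    by apply/funext => w; rewrite /= EFinD.
  by apply: integrableD => //; exact: ii.
under eq_integral do rewrite EFinD.
rewrite (integralD measurableT i12 (ii _ c3 m3)) i1//.
under eq_integral do rewrite /= EFinD.
by rewrite (integralD measurableT (ii _ c1 m1) (ii _ c2 m2)) !i1.
Qed.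

(** [f] is squeezed between two functions constant on each of [A] minus [Bad], the complement of [A]
    minus [Bad], and [Bad]. The first two weights are within [2 * b] of one half and the third is at
    most [b], so the loss is at most [e + 5 * M * b]; the 6 leaves room. *)
Lemma integral_two_values (A Bad : set Omega) (f : Omega -> R) (F1 F2 M e b : R) :
  measurable A -> measurable Bad ->
  (forall w, `|f w| <= M) -> `|F1| <= M -> `|F2| <= M ->
  (forall w, ~ Bad w -> A w -> `|F1 - f w| <= e) ->
  (forall w, ~ Bad w -> ~ A w -> `|F2 - f w| <= e) ->
  0 <= e -> pr P Bad <= b -> 1 / 2 - b <= pr P A <= 1 / 2 + b ->
  ((((F1 + F2) / 2 - (e + 6 * M * b))%:E <= \int[P]_w (f w)%:E)%E /\
   (\int[P]_w (f w)%:E <= ((F1 + F2) / 2 + (e + 6 * M * b))%:E)%E).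
Proof.
move=> mA mB fM F1M F2M H1 H2 e0 Bb /andP[A1 A2].
pose p := pr P (A `\` Bad); pose q := pr P (~` A `\` Bad).
have mAc := measurableC mA.
have m1 : measurable (A `\` Bad) by exact: measurableD.
have m2 : measurable (~` A `\` Bad) by exact: measurableD.
have M0 : 0 <= M by apply: le_trans F1M.
have b0 : 0 <= pr P Bad by exact: pr_ge0.
have pA : pr P A = pr P (A `&` Bad) + p by exact: pr_setI_D.
have pAc : pr P (~` A) = pr P (~` A `&` Bad) + q by exact: pr_setI_D.
have AB : pr P (A `&` Bad) <= pr P Bad.
  by apply: le_pr => //; exact: measurableI.
have AcB : pr P (~` A `&` Bad) <= pr P Bad.
  by apply: le_pr => //; exact: measurableI.
have AB0 := pr_ge0 P (A `&` Bad); have AcB0 := pr_ge0 P (~` A `&` Bad).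
have tot : pr P A + pr P (~` A) = 1.
  by rewrite -pr_setU// ?setUv ?prT// setICr.
have p0 : 0 <= p by exact: pr_ge0.
have q0 : 0 <= q by exact: pr_ge0.
have num (F c : R) : `|F| <= M -> `|c| <= 2 * b -> `|F * c| <= 2 * M * b.
  by move=> FM cb; rewrite normrM (_ : 2 * M * b = M * (2 * b)); [exact: ler_pM | ring].
have := num F1 (p - 1 / 2) F1M ltac:(rewrite ler_norml; lra).
have := num F2 (q - 1 / 2) F2M ltac:(rewrite ler_norml; lra).
rewrite !ler_norml => /andP[n1 n2] /andP[n3 n4].
have Mb : M * pr P Bad <= M * b by rewrite ler_wpM2l.
have epq : e * (p + q) <= e by rewrite ler_piMr//; lra.
have ind (w : Omega) (G : set Omega) : G w -> \1_G w = 1 :> R by move=> Gw; rewrite indicE mem_set.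
have ind0 (w : Omega) (G : set Omega) : ~ G w -> \1_G w = 0 :> R by move=> Gw; rewrite indicE memNset.
have cases (w : Omega) : [\/ [/\ \1_(A `\` Bad) w = 1 :> R, \1_(~` A `\` Bad) w = 0 :> R,
      \1_Bad w = 0 :> R & `|F1 - f w| <= e],
    [/\ \1_(A `\` Bad) w = 0 :> R, \1_(~` A `\` Bad) w = 1 :> R, \1_Bad w = 0 :> R & `|F2 - f w| <= e] |
    [/\ \1_(A `\` Bad) w = 0 :> R, \1_(~` A `\` Bad) w = 0 :> R & \1_Bad w = 1 :> R]].
  have [Bw|nB] := pselect (Bad w).
    by apply: Or33; split; [apply: ind0 => -[]|apply: ind0 => -[]|exact: ind].
  have [Aw|nA] := pselect (A w).
    by apply: Or31; split; [exact: ind|apply: ind0 => -[]|exact: ind0|exact: H1].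
  by apply: Or32; split; [apply: ind0 => -[]|exact: ind|exact: ind0|exact: H2].
split.
- apply: le_trans (_ : (\int[P]_w ((F1 - e) * \1_(A `\` Bad) w +
     (F2 - e) * \1_(~` A `\` Bad) w + (- M) * \1_Bad w)%:E <= _)%E); last first.
    apply: le_integral_arbitrary => w; rewrite lee_fin.
    have := fM w; rewrite ler_norml => /andP[f1 f2].
    by case: (cases w) => [[-> -> ->]|[-> -> ->]|[-> -> ->]]; rewrite ?ler_norml; lra.
  rewrite integral_three_indic// lee_fin -/p -/q; lra.
- apply: le_trans (_ : (_ <= \int[P]_w ((F1 + e) * \1_(A `\` Bad) w +
     (F2 + e) * \1_(~` A `\` Bad) w + M * \1_Bad w)%:E)%E) _.
    apply: le_integral_arbitrary => w; rewrite lee_fin.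
    have := fM w; rewrite ler_norml => /andP[f1 f2].
    by case: (cases w) => [[-> -> ->]|[-> -> ->]|[-> -> ->]]; rewrite ?ler_norml; lra.
  rewrite integral_three_indic// lee_fin -/p -/q; lra.
Qed.

End Sandwich.


(** * Budgets for the parameters, and the limit theorem *)

Lemma log_budget (R : realType) (L : R -> R) (D : R) : 0 < D ->
  (forall s, 0 < s -> 0 < L s) ->
  (forall eps : R, 0 < eps -> exists2 e : R, 0 < e & forall s, 0 < s -> s < e ->
      `|L s * (`|ln s| `^ (- 8^-1))| < eps) ->
  eventually0 (fun s => (D * L s) ^+ 2 / 2 <= - ln s).
Proof.
move=> D0 L0 Llog.
have DV : 0 < D^-1 by rewrite invr_gt0.
have [e e0 He] := Llog _ DV.
(* Below 1/e one has |ln s| > 1, so the power 1/8 in the growth assumption is dominated by the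
   square root, and squaring gives the claim. *)
exists (Num.min e (expR (-1))); first by rewrite lt_min e0 expR_gt0.
move=> s s0; rewrite lt_min => /andP[se s1] _.
have ln1 : 1 < - ln s.
  rewrite ltrNr -[X in _ < X]expRK ltr_ln ?posrE ?expR_gt0//.
have := He s s0 se; rewrite (ltr0_norm (_ : ln s < 0)); last by lra.
set lam := - ln s in ln1 *.
have p0 : 0 < lam `^ 8^-1 by rewrite powR_gt0//; lra.
rewrite powRN gtr0_norm ?divr_gt0 ?L0// ltr_pdivrMr// => h.
have DLp : D * L s < lam `^ 8^-1 by rewrite mulrC -ltr_pdivlMr// mulrC.
have DLs : D * L s <= Num.sqrt lam.
  apply: le_trans (ltW DLp) _; rewrite -powR12_sqrt; last lra.
  by apply: ler_powR; [lra|rewrite lef_pV2 ?posrE//; lra].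
have DL0 : 0 <= D * L s by rewrite mulr_ge0// ltW// L0.
have : (D * L s) ^+ 2 <= Num.sqrt lam ^+ 2 by rewrite ler_sqr ?nnegrE// sqrtr_ge0.
rewrite sqr_sqrtr; lra.
Qed.

(** All constants that do not depend on the noise level are fixed here. The final distance will be
    [3 * beta] and the total loss in the margin [2 * beta]; the factor 8 places the first strictly
    below [d1], [d2] and [kT], and the second below [m * a / 2]. *)
Lemma scale_parameters (R : realType) (T delta d1 d2 m Mk kT b C1 : R) :
  0 < T -> 0 < delta -> delta < T -> 0 < d1 -> 0 < d2 -> 0 < m -> 0 < Mk -> 0 < kT ->
  0 < b -> 0 < C1 ->
  exists a beta, [/\ [/\ 0 < a, a < delta & a <= T],
    [/\ 0 < beta, 8 * beta <= d1, 8 * beta <= d2, 8 * beta <= m * a & 8 * beta <= kT],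
    exists ep, [/\ 0 < ep, ep <= 1 / 4 & 2 * ep * kT <= beta],
    exists tau, [/\ 0 < tau, tau <= a / 2, 2 * (Mk * tau) <= beta & tau < T] &
    (exists K, 0 < K /\ 32 * T / K ^+ 2 <= b / 4) /\
    exists c, [/\ 0 < c, C1 * c <= 1 / 2 & C1 * c <= m / 8]].
Proof.
move=> T0 d0 dT d10 d20 m0 Mk0 kT0 b0 C10.
have a0 : 0 < delta / 2 by lra.
have ma0 : 0 < m * (delta / 2) by rewrite mulr_gt0.
exists (delta / 2).
pose beta := Num.min (Num.min d1 d2) (Num.min (m * (delta / 2)) kT) / 8.
have beta0 : 0 < beta by rewrite divr_gt0// !lt_min d10 d20 ma0 kT0.
have betaE : 8 * beta = Num.min (Num.min d1 d2) (Num.min (m * (delta / 2)) kT).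
  by rewrite /beta; field.
clearbody beta; have kT2 : 0 < 2 * kT by rewrite mulr_gt0.
have Mk2 : 0 < 2 * Mk by rewrite mulr_gt0.
exists beta; split.
- by split; lra.
- by split; rewrite // betaE !ge_min lexx ?orbT.
- exists (Num.min (1 / 4) (beta / (2 * kT))); split.
  + by rewrite lt_min !divr_gt0.
  + by rewrite ge_min lexx.
  + have : Num.min (1 / 4) (beta / (2 * kT)) <= beta / (2 * kT) by rewrite ge_min lexx orbT.
    by rewrite ler_pdivlMr//; lra.
- exists (Num.min (delta / 2 / 2) (beta / (2 * Mk))).
  have h1 : Num.min (delta / 2 / 2) (beta / (2 * Mk)) <= delta / 2 / 2 by rewrite ge_min lexx.
  have h2 : Num.min (delta / 2 / 2) (beta / (2 * Mk)) <= beta / (2 * Mk).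
    by rewrite ge_min lexx orbT.
  split => //; [by rewrite lt_min !divr_gt0| |lra].
  by move: h2; rewrite ler_pdivlMr//; lra.
split.
  have q0 : 0 < 32 * T / (b / 4) by rewrite !divr_gt0// mulr_gt0.
  (* The summand 1 gives [K <= K ^+ 2], so a bound linear in [K] suffices. *)
  exists (1 + 32 * T / (b / 4)); split; first lra.
  set K := 1 + _; have K1 : 1 <= K by rewrite /K; lra.
  have K0 : 0 < K by lra.
  rewrite ler_pdivrMr ?exprn_gt0//; apply: (@le_trans _ _ (b / 4 * K)).
    have -> : b / 4 * K = b / 4 + 32 * T by rewrite /K; field; rewrite gt_eqF.
    by lra.
  by rewrite ler_pM2l ?divr_gt0// expr2 ler_peMl// ltW.
exists (Num.min (1 / 2) (m / 8) / C1); split.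
- by rewrite divr_gt0// lt_min !divr_gt0.
- by rewrite mulrC divfK ?gt_eqF// ge_min lexx.
- by rewrite mulrC divfK ?gt_eqF// ge_min lexx orbT.
Qed.

Theorem mainTheorem9 (R : realType) (T kappa delta : R) (eta : R -> R)
  (d : measure_display) (Omega : R -> measurableType d)
  (P : forall s : R, probability (Omega s) R)
  (Fil : forall s : R, R -> set (set (Omega s)))
  (B mu Y Dl : forall s : R, R -> Omega s -> R)
  (thetat : R -> R -> R -> R) (L : R -> R) :
  0 < T -> 0 < delta -> delta < T ->
  riccati_sol T kappa eta ->
  (* (A1) *)
  (forall s, 0 < s -> 0 < L s) ->
  (forall M : R, exists2 e : R, 0 < e & forall s, 0 < s -> s < e -> M < L s) ->
  (forall eps : R, 0 < eps -> exists2 e : R, 0 < e & forall s, 0 < s -> s < e ->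
      `|L s * (`|ln s| `^ (- 8^-1))| < eps) ->
  (forall s, 0 < s -> s < 1 ->
      cont_on_strip T (thetat s) /\ (forall t x, -1 <= thetat s t x <= 1)) ->
  (forall psi, admissible T kappa delta eta psi ->
     forall eps : R, 0 < eps -> exists2 e : R, 0 < e &
       forall s, 0 < s -> s < e -> s < 1 ->
         forall t x, 0 <= t <= T -> s ^+ 2 * L s + psi t <= `|x| ->
           `|thetat s t x - theta T kappa delta eta t x| <= eps) ->
  (* (A2) *)
  (forall s, 0 < s -> s < 1 ->
     filtration (Fil s) /\ brownian T (P s) (Fil s) (B s) /\
     (adapted T (Fil s) (mu s) /\ adapted T (Fil s) (Y s) /\
      adapted T (Fil s) (Dl s)) /\
     (cont_paths T (mu s) /\ cont_paths T (Y s) /\ cont_paths T (Dl s)) /\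
     (forall t w, 0 <= t <= T -> -1 <= Y s t w <= 1) /\
     (forall t, 0 <= t <= T ->
        cvg_in_prob (P s)
          (fun n w => s * riemann_dB (fun u => (wfun T kappa eta u)^-1) (B s) t n w)
          (fun w => mu s t w +
             Rintegral (@lebesgue_measure R) `[0, t]
               (fun u => (wfun T kappa eta u) ^- 2 * Y s u w))) /\
     (forall t w, 0 <= t <= T -> Y s t w = thetat s t (mu s t w) - Dl s t w)) ->
  (forall eps e : R, 0 < eps -> 0 < e -> exists2 e' : R, 0 < e' &
     forall s, 0 < s -> s < e' -> s < 1 ->
       (P s [set w | exists t, (0 <= t <= T)%R /\ (eps < `|Dl s t w|)%R] < e%:E)%E) ->
  (* (A3) *)
  (forall s, 0 < s -> s < 1 -> forall A, path_sigma T A ->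
     P s ((fun w t => mu s t w) @^-1` A) = P s ((fun w t => - mu s t w) @^-1` A)) ->
  (* conclusion: weak convergence of the laws to (1/2) delta_k + (1/2) delta_{-k} *)
  forall F, bcont_functional T F ->
  forall eps : R, 0 < eps -> exists2 e : R, 0 < e &
    forall s, 0 < s -> s < e -> s < 1 ->
      let l := (F (kfun T kappa eta) + F (fun t => - kfun T kappa eta t)) / 2 in
      ((l - eps)%:E < \int[P s]_w (F (fun t => mu s t w))%:E < (l + eps)%:E)%E.
Proof.
move=> T0 d0 dT [/within_contP ceta _] L0 Linf Llog _ HA1 HA2 HDl HA3 F [[M0 FM0] Fcont] eps eps0.
have [gm [gM [Lip [gm0 gM0 Lip0 gb gLip]]]] := wfunV_bounds (kappa := kappa) T0 ceta.
have [m [Mk [m0 Mk0 kb]]] := kfun_bilipschitz (kappa := kappa) T0 ceta.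
set k := kfun T kappa eta in kb *.
have k0 : k 0 = 0 by exact: kfun0.
have ck : cont_on 0 T k by exact: cont_on_kfun.
have wk : {within `[0, T], continuous k} by apply/within_contP.
have wNk : {within `[0, T], continuous (fun t => - k t)}.
  by apply/within_contP; exact: cont_onN.
pose M := `|M0| + 1.
have M_gt0 : 0 < M by rewrite /M; have := normr_ge0 M0; lra.
have FM z : {within `[0, T], continuous z} -> `|F z| <= M.
  by move=> /FM0 h; apply: le_trans h _; rewrite /M; have := ler_norm M0; lra.
pose e := eps / 4; have e_gt0 : 0 < e by rewrite /e; lra.
(* With this [b] the term [6 * M * b] equals [eps / 8]; together with [e = eps / 4] the error stays
   strictly below [eps]. *)
pose b := eps / (48 * M); have b_gt0 : 0 < b by rewrite divr_gt0// mulr_gt0.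
have [d1 d10 Hd1] := Fcont _ wk _ e_gt0.
have [d2 d20 Hd2] := Fcont _ wNk _ e_gt0.
have kT0 : 0 < k T.
  have /andP[h _] := kb 0 T (lexx 0) (ltW T0) (lexx T).
  by apply: lt_le_trans (_ : m * T <= _); [rewrite mulr_gt0 | move: h; rewrite k0 !subr0].
pose C1 := gM + Lip * T.
have C10 : 0 < C1 by rewrite addr_gt0// mulr_gt0.
have [a [beta [[a0 ad aT] [beta0 bd1 bd2 bma bkT]
  [ep [ep0 ep4 epkT]] [tau [tau0 taua tauM tauT]] [[K [K0 KT]] [c [c0 c_half c_m]]]]]] :=
  scale_parameters T0 d0 dT d10 d20 m0 Mk0 kT0 b_gt0 C10.
have [rho rhoE] : exists rho, rho = beta / 2 by exists (beta / 2).
have [eta' eta'E] : exists eta', eta' = b / 4 by exists (b / 4).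
have rho0 : 0 < rho by rewrite rhoE divr_gt0.
have eta'0 : 0 < eta' by rewrite eta'E divr_gt0.
rewrite -eta'E in KT.
pose D := (4 + 2 * K * Lip * T + Mk * T) / gm / Num.sqrt (T / 2) + 1.
have D0 : 0 < D.
  rewrite ltr_pwDr// !divr_ge0 ?sqrtr_ge0 ?(ltW gm0)//.
  by rewrite !addr_ge0 ?mulr_ge0 ?(ltW K0) ?(ltW Lip0) ?(ltW T0) ?(ltW Mk0).
(* After insertion of l = s^2 L, the return bound of the dichotomy is 64 / (c^2 L), so it falls
   below [eta'] because [L] tends to infinity. *)
have ev1 : eventually0 (fun s => Num.max 1 (64 / c ^+ 2 / eta') < L s).
  by have [r r0 Hr] := Linf (Num.max 1 (64 / c ^+ 2 / eta')); exists r => // s s0 sr _; exact: Hr.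
have ev2 := log_budget D0 L0 Llog.
have sq0 : 0 < Num.sqrt (pi *+ 2 : R) by exact: lt_trans ltr01 (sqrt2pi_gt1 (R := R)).
have ev3 : eventually0 (fun s => s < tau / (2 * T)).
  by apply: eventually0_lt; rewrite divr_gt0// mulr_gt0.
have ev4 : eventually0 (fun s => s < eta' * tau / (2 * T * Num.sqrt (pi *+ 2))).
  by apply: eventually0_lt; rewrite divr_gt0// !mulr_gt0.
have ev5 : eventually0 (fun s => s < rho / (C1 * K)).
  by apply: eventually0_lt; rewrite !divr_gt0// mulr_gt0.
have ev6 := HDl _ _ ep0 eta'0.
have ev7 := HA1 _ (admissible_barrier T0 ceta (ltW a0) ad dT) _ ep0.
apply: (eventually0_sub (eventually0I ev1 (eventually0I ev2 (eventually0I ev3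
  (eventually0I ev4 (eventually0I ev5 (eventually0I ev6 ev7))))))) => {ev1 ev2 ev3 ev4 ev5 ev6 ev7}.
move=> s s0 s1 [s_L [s_log [s_tau [s_eta [s_rho [s_Dl s_th]]]]]].
have [HF [HB [[amu [aY aDl]] [[cmu' [cY' cDl']] [Y1 [cvgN YE]]]]]] := HA2 s s0 s1.
have cmu w : cont_on 0 T (fun t => mu s t w) by apply/within_contP.
have cY w : cont_on 0 T (fun t => Y s t w) by apply/within_contP.
have cDl w : cont_on 0 T (fun t => Dl s t w) by apply/within_contP.
have [L1 LC] : 1 < L s /\ 64 / c ^+ 2 / eta' < L s by apply/andP; rewrite -gt_max.
have l0 : 0 < s ^+ 2 * L s by rewrite mulr_gt0 ?exprn_gt0// L0.
have num1 : 2 * T * s ^+ 2 <= tau.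
  have h : 2 * T * s <= tau by move: s_tau; rewrite ltr_pdivlMr ?mulr_gt0// => /ltW; rewrite mulrC.
  apply: le_trans h; rewrite ler_pM2l ?mulr_gt0//.
  by rewrite expr2 ler_piMr ?ltW.
have num2 : 2 * T * s * Num.sqrt (pi *+ 2) <= eta' * tau.
  rewrite (_ : _ * _ = s * (2 * T * Num.sqrt (pi *+ 2))); last by ring.
  by move: s_eta; rewrite ltr_pdivlMr ?mulr_gt0// => /ltW.
have [n [n0 [x [n_gt0 n0n x0 ttau [jmp esc]]]]] := escape_parameters tau0 tauT gm0
  (ltW Lip0) (ltW Mk0) (ltW K0) (erefl D) s0 s1 (ltW L1) s_log num1 num2.
have [J HJ] : exists J, T <= 2 ^+ J * (s ^+ 2 * L s).
  exists (Num.truncn (T / (s ^+ 2 * L s))).+1.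
  rewrite -ler_pdivrMr//; apply: le_trans (ltW (truncnS_gt _)) _.
  by rewrite -natrX ler_nat ltnW// ltn_expl.
have noise_small : s * (gM + Lip * T) * K <= rho.
  by rewrite -mulrA -/C1; move: s_rho; rewrite ltr_pdivlMr ?mulr_gt0//; exact: ltW.
have t0n : 0 <= T * (n0%:R / n%:R) <= T.
  by apply: grid_time => //; exact: ltnW.
have ktau : k (T * (n0%:R / n%:R)) <= Mk * tau.
  have /andP[h1 h2] := t0n.
  have /andP[_] := kb 0 _ (lexx 0) h1 h2; rewrite k0 !subr0 => /le_trans; apply.
  by rewrite ler_pM2l.
have time_half := le_trans ttau taua.
have time_small : T * (n0%:R / n%:R) <= a by move: time_half a0; clear; lra.
have margin : 2 * ep * k T + 2 * rho < k a - k (T * (n0%:R / n%:R)).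
  have /andP[h1 h2] := t0n.
  have /andP[h3 _] := kb _ _ h1 time_small aT.
  have : m * (a / 2) <= m * (a - T * (n0%:R / n%:R)) by rewrite ler_pM2l//; move: time_half; clear; lra.
  by rewrite rhoE; move: h3 epkT bma beta0; clear; lra.
have thE t y : 0 <= t <= T -> s ^+ 2 * L s + Num.max (k t - k a) 0 <= `|y| ->
    `|thetat s t y + Num.sg y| <= ep.
  move=> tT yl; have := s_th t y tT yl.
  by rewrite (theta_above_barrier T0 ceta (ltW a0) ad dT l0 tT yl) opprK.
have [Bad [mBad PBad HBad]] := dichotomy T0 ceta s0 HF HB amu aY aDl cmu cY cDl Y1 cvgN YE
  gm0 gM0 Lip0 m0 gb gLip kb n_gt0 n0n l0 ep0 ep4 K0 x0 c0 aT thE noise_small jmp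
  c_half c_m HJ time_small margin.
rewrite -/k in HBad.
(* One [beta] each for the time spent before escape, for the drift deficit and for the noise. *)
have radius : 2 * k (T * (n0%:R / n%:R)) + 2 * ep * k T + 2 * rho <= 3 * beta.
  by rewrite rhoE; move: ktau tauM epkT; clear; lra.
have PBadb : pr (P s) Bad <= b.
  apply: le_trans PBad _.
  have p2 : pr (P s) [set w | exists t, (0 <= t <= T) /\ (ep < `|Dl s t w|)] <= eta'.
    rewrite -lee_fin -prE; last exact: (sup_gt_measurable T0 HF aDl cDl).
    exact: ltW.
  have p4 : 64 * s ^+ 2 / (c ^+ 2 * (s ^+ 2 * L s)) <= eta'.
    have -> : 64 * s ^+ 2 / (c ^+ 2 * (s ^+ 2 * L s)) = 64 / c ^+ 2 / L s.
      by field; rewrite !gt_eqF// L0.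
    by move: LC; rewrite ltr_pdivrMr// ler_pdivrMr ?L0// => /ltW; rewrite (mulrC eta').
  have -> : b = eta' + eta' + eta' + eta' by rewrite eta'E; clear; lra.
  by move: KT p2 esc p4; clear; lra.
have T0T : 0 <= T <= T by rewrite lexx ltW.
(* The sign at [T] tells the alternatives apart: outside [Bad] the path ends within [3 * beta] of
   [k T] or [- k T], and [8 * beta <= k T]. *)
pose A := [set w | 0 < mu s T w]; pose A' := [set w | 0 < - mu s T w].
have mmuT := adapted_measurable HF amu T0T.
have mA : measurable A.
  by apply: (fil_measurable HF (t := T)); apply: meas_wrt_gt => U mU; exact: amu.
have mA' : measurable A'.
  have -> : A' = mu s T @^-1` `]-oo, 0[.
    by apply/seteqP; split => w /=; rewrite /A'/= in_itv/= oppr_gt0.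
  by rewrite -[X in measurable X]setTI; exact: mmuT.
have sym : pr (P s) A = pr (P s) A'.
  have := HA3 s s0 s1 ((fun z : R -> R => z T) @^-1` `]0, +oo[) _.
  rewrite /pr => H; congr fine.
  have E1 : A = (fun w t => mu s t w) @^-1` ((fun z : R -> R => z T) @^-1` `]0, +oo[).
    by apply/seteqP; split => w; rewrite /A /= in_itv/= andbT.
  have E2 : A' = (fun w t => - mu s t w) @^-1` ((fun z : R -> R => z T) @^-1` `]0, +oo[).
    by apply/seteqP; split => w; rewrite /A' /= in_itv/= andbT.
  rewrite E1 E2; apply: H; apply: sub_sigma_algebra.
  exists T; first exact: T0T.
  by exists `]0, +oo[%classic => //; exact: measurable_itv.
have far w : ~ Bad w -> (A w /\ forall t, 0 <= t <= T -> `|mu s t w - k t| <= 3 * beta) \/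
    (A' w /\ forall t, 0 <= t <= T -> `|mu s t w + k t| <= 3 * beta).
  move=> /HBad[h|h]; [left|right]; split.
  - by have := h T T0T; rewrite ler_norml /A/=; move: radius bkT beta0; clear; lra.
  - by move=> t /h h'; apply: le_trans radius.
  - by have := h T T0T; rewrite ler_norml /A'/=; move: radius bkT beta0; clear; lra.
  - by move=> t /h h'; apply: le_trans radius.
have AA' : A `&` A' = set0.
  by apply/seteqP; split => // w []; rewrite /A /A'/=; clear; lra.
(* [A] and [A'] are disjoint, equally likely by symmetry, and cover everything but [Bad]; twice the
   probability of [A] is thus between [1 - b] and 1. *)
have half : 1 / 2 - b <= pr (P s) A <= 1 / 2 + b.
  have mAA' := measurableU _ _ mA mA'.
  have := pr_setU (P s) mA mA' AA'; rewrite -sym.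
  have := pr_le1 (P s) mAA'.
  have := pr_setU_le (P s) mAA' mBad.
  have -> : A `|` A' `|` Bad = setT.
    apply/seteqP; split => // w _; have [|/far[[]|[]]] := pselect (Bad w).
    - by right.
    - by left; left.
    - by left; right.
  by rewrite prT; move: PBadb b_gt0; clear; lra.
have wmu w : {within `[0, T], continuous (fun t => mu s t w)} by exact: cmu'.
have [||lo hi] := @integral_two_values _ _ _ (P s) A Bad (fun w => F (fun t => mu s t w))
  (F k) (F (fun t => - k t)) M e b mA mBad (fun w => FM _ (wmu w)) (FM _ wk) (FM _ wNk)
  _ _ (ltW e_gt0) PBadb half.
- move=> w nBad Aw; case: (far w nBad) => [[_ h]|[A'w _]]; last first.
    by have : (A `&` A') w by []; rewrite AA'.
  apply/ltW/Hd1 => // t tT; have := h t tT.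
  by rewrite distrC; move: bd1 beta0; clear; lra.
- move=> w nBad nAw; case: (far w nBad) => [[Aw _]|[_ h]]; first by [].
  apply/ltW/Hd2 => // t tT; have := h t tT.
  rewrite (_ : - k t - mu s t w = - (mu s t w + k t)); last by ring.
  by rewrite normrN; move: bd2 beta0; clear; lra.
have bE : 6 * M * b = eps / 8 by rewrite /b; field; rewrite gt_eqF.
cbv zeta; rewrite -/k; apply/andP; split.
- by apply: lt_le_trans lo; rewrite lte_fin bE /e; move: eps0; clear; lra.
- by apply: le_lt_trans hi _; rewrite lte_fin bE /e; move: eps0; clear; lra.
Qed.
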